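(* Let $\Lambda$ be a finite dimensional basic and split Hopf algebra over a field $k$, with structure group $\mathcal S$ (not necessarily abelian) and canonical element $c=\overline{P_1}\in\mathbf Z\mathcal S$. Then $K_0^p(\Lambda)$ is a ring isomorphic to $\mathbf Z\mathcal S\oplus\mathbf Z\mathcal S$, where the first factor is the group ring and the multiplication is given by $$(s_1,t_1)(s_2,t_2)=(s_1s_2,\; s_1t_2+t_1s_2+t_1\,c\,t_2)\qquad (s_1,s_2,t_1,t_2\in\mathbf Z\mathcal S).$$
   Context: Let $\Lambda$ be a finite dimensional Hopf algebra over a field $k$ with counit $\varepsilon$. Modules are finitely generated left $\Lambda$-modules; $M\otimes N$ means the tensor product over $k$ with $\Lambda$-action through the comultiplication. $\Lambda$ is split if the endomorphism ring of every simple module is isomorphic to $k$, and basic if every simple module has multiplicity one in the maximal semisimple quotient algebra of $\Lambda$; basic and split together mean that all simple modules are one-dimensional over $k$. In that case the set $\mathcal S$ of isomorphism classes of simple modules is a group under $\otimes$, with unit the trivial module $k_\varepsilon$ ($k$ with action through $\varepsilon$) and $S^{-1}=S^*$, where $S^*=\mathrm{Hom}_k(S,k)$ is made a left module by means of the antipode; $\mathcal S$ is called the structure group of $\Lambda$. $K_0(\Lambda)$ is the free abelian group on isomorphism classes $[X]$ of modules modulo the relations $[X_2]=[X_1]+[X_3]$ for every split exact sequence $0\to X_1\to X_2\to X_3\to 0$; it is a ring with product induced by $\otimes$ and unit $[k_\varepsilon]$. The projective class ring $K_0^p(\Lambda)$ is the subring of $K_0(\Lambda)$ generated by the classes of projective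 modules and semisimple modules. For a module $M$, $\overline M$ denotes the sum of the composition factors of $M$ counted with multiplicity, viewed as an element of the integral group ring $\mathbf Z\mathcal S$. $P_1$ denotes the projective cover of $k_\varepsilon$, and the canonical element is $c=\overline{P_1}\in\mathbf Z\mathcal S$.
   Formalization: The formal theorem adds that Λ is not semisimple; for semisimple Λ (e.g. Λ = k) the claim is false, since K_0^p(Λ) = ZS has rank |S| while ZS ⊕ ZS has rank 2|S|. *)

(* Defs.v *)
From HB Require Import structures.
From mathcomp Require Import all_boot all_order all_algebra all_field.
From mathcomp Require Import boolp.
From mathcomp.real_closed Require Import mxtens.
From mathcomp Require Import finmap.
From mathcomp.multinomials Require Import monalg.

Set Implicit Arguments.
Unset Strict Implicit.
Unset Printing Implicit Defensive.

Import GRing.Theory.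
Local Open Scope ring_scope.

Section Tensor.
Context {k : fieldType}.

(* t represents \sum_(i, j) t i j e_i (x) e'_j, where e and e' are the bases
   vbasis {:U} and vbasis {:V}. *)
Definition tensor (U V : vectType k) : vectType k :=
  'M[k]_(\dim {:U}%VS, \dim {:V}%VS).

Definition tpure {U V : vectType k} (u : U) (v : V) : tensor U V :=
  \matrix_(i, j) (coord (vbasis {:U}%VS) i u * coord (vbasis {:V}%VS) j v).

(* The value at t of the linear map induced by a bilinear f. *)
Definition tlift {U V : vectType k} {W : lmodType k} (f : U -> V -> W)
    (t : 'M[k]_(\dim {:U}%VS, \dim {:V}%VS)) : W :=
  \sum_i \sum_j t i j *: f (vbasis {:U}%VS)`_i (vbasis {:V}%VS)`_j.

Definition bilin {U V W : lmodType k} (f : U -> V -> W) :=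
  (forall v, linear (f^~ v)) /\ (forall u, linear (f u)).

End Tensor.

(* (x (x) y) (z (x) w) = x z (x) y w *)
Definition tmul {k : fieldType} {L : falgType k} (t u : tensor L L) :
    tensor L L :=
  tlift (fun x y => tlift (fun z w => tpure (x * z) (y * w)) u) t.

HB.mixin Record Falgebra_isHopf (k : fieldType) L of Falgebra k L := {
  comul : L -> tensor L L;
  counit : L -> k;
  antipode : L -> L;
  comul_is_linear : linear comul;
  comul1 : comul 1 = tpure 1 1;
  comulM : forall a b, comul (a * b) = tmul (comul a) (comul b);
  counit_is_scalar : scalar counit;
  counit1 : counit 1 = 1;
  counitM : forall a b, counit (a * b) = counit a * counit b;
  comulA : forall a,
    tlift (fun x z => tlift (fun x1 x2 => tpure x1 (tpure x2 z)) (comul x))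
      (comul a)
    = tlift (fun x y => tpure x (comul y)) (comul a) :> tensor L (tensor L L);
  counitl : forall a, tlift (fun x y => counit x *: y) (comul a) = a;
  counitr : forall a, tlift (fun x y => counit y *: x) (comul a) = a;
  antipode_is_linear : linear antipode;
  antipodel : forall a,
    tlift (fun x y => antipode x * y) (comul a) = counit a *: 1;
  antipoder : forall a,
    tlift (fun x y => x * antipode y) (comul a) = counit a *: 1
}.

#[short(type="hopfAlgType")]
HB.structure Definition HopfAlg (k : fieldType) :=
  { L of Falgebra_isHopf k L & Falgebra k L }.

Section TensorTheory.
Context {k : fieldType}.
Implicit Types U V W : vectType k.

Lemma linear_sumZ (U W : lmodType k) (g : U -> W) I (r : seq I) (c : I -> k) F :
  linear g -> g (\sum_(i <- r) c i *: F i) = \sum_(i <- r) c i *: g (F i).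
Proof.
move=> lg; pose G := GRing.isLinear.Build k U W _ g lg.
pose g' : {linear U -> W} := HB.pack g G.
by rewrite -[g]/(g' : _ -> _) linear_sum; apply: eq_bigr => i _; rewrite linearZ.
Qed.

Lemma linear_sum' (U W : lmodType k) (g : U -> W) I (r : seq I) F :
  linear g -> g (\sum_(i <- r) F i) = \sum_(i <- r) g (F i).
Proof.
move=> lg; have := linear_sumZ r (fun=> 1) F lg.
by under eq_bigr do rewrite scale1r; under [in RHS]eq_bigr do rewrite scale1r.
Qed.

Lemma linear_Z (U W : lmodType k) (g : U -> W) c u :
  linear g -> g (c *: u) = c *: g u.
Proof.
by move=> lg; have := linear_sumZ [:: tt] (fun=> c) (fun=> u) lg; rewrite !big_seq1.
Qed.

Lemma basis_sum U (u : U) :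
  u = \sum_i coord (vbasis {:U}%VS) i u *: (vbasis {:U}%VS)`_i.
Proof. by apply: coord_vbasis; rewrite memvf. Qed.

Lemma tlift_pure U V (W : lmodType k) (f : U -> V -> W) u v :
  bilin f -> tlift f (tpure u v) = f u v.
Proof.
move=> [fl fr]; rewrite [in RHS](basis_sum u) (linear_sumZ _ _ _ (fl v)).
apply: eq_bigr => i _; rewrite [in RHS](basis_sum v) (linear_sumZ _ _ _ (fr _)).
by rewrite scaler_sumr; apply: eq_bigr => j _; rewrite mxE scalerA.
Qed.

Lemma tlift_linear U V (W : lmodType k) (f : U -> V -> W) : linear (tlift f).
Proof.
move=> c t u; rewrite /tlift scaler_sumr -big_split; apply: eq_bigr => i _ /=.
rewrite scaler_sumr -big_split; apply: eq_bigr => j _ /=.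
by rewrite !mxE scalerDl scalerA.
Qed.

Lemma eq_tlift U V (W : lmodType k) (f g : U -> V -> W) :
  f =2 g -> tlift f =1 tlift g.
Proof.
by move=> e t; apply: eq_bigr => i _; apply: eq_bigr => j _; rewrite e.
Qed.

Lemma comp_tlift U V (W W' : lmodType k) (g : W -> W') (f : U -> V -> W) t :
  linear g -> g (tlift f t) = tlift (fun u v => g (f u v)) t.
Proof.
move=> lg; rewrite /tlift linear_sum' //; apply: eq_bigr => i _.
exact: linear_sumZ.
Qed.

Lemma exchange_tlift U V U' V' (W : lmodType k) (f : U -> V -> U' -> V' -> W) t s :
  tlift (fun u v => tlift (fun u' v' => f u v u' v') s) t =
  tlift (fun u' v' => tlift (fun u v => f u v u' v') t) s.
Proof.
transitivity (tlift (fun u v => \sum_i \sum_j s i j *: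
   f u v (vbasis {:U'}%VS)`_i (vbasis {:V'}%VS)`_j) t) => //.
rewrite /tlift.
under eq_bigr do under eq_bigr do rewrite scaler_sumr.
under eq_bigr do rewrite exchange_big.
rewrite exchange_big; apply: eq_bigr => i _.
under eq_bigr do under eq_bigr do rewrite scaler_sumr.
under eq_bigr do rewrite exchange_big.
rewrite exchange_big; apply: eq_bigr => j _.
rewrite scaler_sumr; apply: eq_bigr => i' _.
rewrite scaler_sumr; apply: eq_bigr => j' _.
by rewrite !scalerA mulrC.
Qed.

Lemma tpure_bilin U V : bilin (@tpure k U V).
Proof.
split=> [v|u] c x y; apply/matrixP => i j; rewrite !mxE linearP.
  by rewrite mulrDl mulrA.
by rewrite mulrDr mulrCA.
Qed.

Lemma tlift_fun_linear U V (U' W : lmodType k) (f : U' -> U -> V -> W) t :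
  (forall u v, linear (fun x => f x u v)) -> linear (fun x => tlift (f x) t).
Proof.
move=> lf c x y; rewrite /tlift scaler_sumr -big_split; apply: eq_bigr => i _ /=.
rewrite scaler_sumr -big_split; apply: eq_bigr => j _ /=.
by rewrite lf scalerDr !scalerA mulrC.
Qed.

Lemma linear_comp' (U V W : lmodType k) (g : V -> W) (f : U -> V) :
  linear g -> linear f -> linear (fun x => g (f x)).
Proof. by move=> lg lf c x y; rewrite lf lg. Qed.

End TensorTheory.

Section HopfTheory.
Context {k : fieldType} {L : hopfAlgType k}.
Implicit Types W : lmodType k.

Lemma comul_mul W (f : L -> L -> W) a b : bilin f ->
  tlift f (comul (a * b)) =
  tlift (fun x y => tlift (fun z w => f (x * z) (y * w)) (comul b)) (comul a).
Proof.
move=> bf; rewrite comulM /tmul (comp_tlift _ _ (tlift_linear _)).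
apply: eq_tlift => x y; rewrite (comp_tlift _ _ (tlift_linear _)).
by apply: eq_tlift => z w; rewrite tlift_pure.
Qed.

Lemma comul_assoc W (F : L -> L -> L -> W) a :
  (forall y z, linear (fun x => F x y z)) ->
  (forall x z, linear (fun y => F x y z)) ->
  (forall x y, linear (fun z => F x y z)) ->
  tlift (fun x z => tlift (fun x1 x2 => F x1 x2 z) (comul x)) (comul a) =
  tlift (fun x y => tlift (fun y1 y2 => F x y1 y2) (comul y)) (comul a).
Proof.
move=> F1 F2 F3; pose T (t : tensor L (tensor L L)) : W :=
  tlift (fun x (s : tensor L L) => tlift (F x) s) t.
have lT : linear T by exact: tlift_linear.
have bT : bilin (fun x (s : tensor L L) => tlift (F x) s).
  split=> [s|x]; last exact: tlift_linear.
  by apply: tlift_fun_linear => u v; exact: F1.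
have := congr1 T (comulA a).
rewrite (comp_tlift _ _ lT) [in X in _ = X -> _](comp_tlift _ _ lT).
have -> : tlift (fun u v => T (tpure u (comul v))) (comul a) =
   tlift (fun x y => tlift (F x) (comul y)) (comul a).
  by apply: eq_tlift => x y; rewrite /T tlift_pure.
move=> <-; apply: eq_tlift => x z; rewrite (comp_tlift _ _ lT).
by apply: eq_tlift => x1 x2; rewrite /T tlift_pure // tlift_pure //; split=> ?.
Qed.

Lemma linear_mulr (U : lmodType k) (f : U -> L) c :
  linear f -> linear (fun x => f x * c).
Proof. by move=> lf a u v; rewrite lf mulrDl scalerAl. Qed.

Lemma linear_mull (U : lmodType k) (f : U -> L) c :
  linear f -> linear (fun x => c * f x).
Proof. by move=> lf a u v; rewrite lf mulrDr scalerAr. Qed.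

Lemma linear_antipode (U : lmodType k) (f : U -> L) :
  linear f -> linear (fun x => antipode (f x)).
Proof. by move=> lf a u v; rewrite lf antipode_is_linear. Qed.

Lemma linear_scale (V : lmodType k) c : linear (fun z : V => c *: z).
Proof. by move=> a u v; rewrite scalerDr !scalerA mulrC. Qed.

Lemma antipode1 : antipode (1 : L) = 1.
Proof.
have := antipodel (1 : L); rewrite comul1 counit1 scale1r tlift_pure ?mulr1 //.
split=> [v|u] c x y; first by rewrite antipode_is_linear mulrDl scalerAl.
by rewrite mulrDr scalerAr.
Qed.

Lemma antipodeM (a b : L) : antipode (a * b) = antipode b * antipode a.
Proof.
pose S := @antipode k L.
have lS : linear S by exact: antipode_is_linear.
have lml (x : L) : linear (fun y => x * y) by move=> c u v; rewrite mulrDr scalerAr.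
have lmr (x : L) : linear (fun y => y * x) by move=> c u v; rewrite mulrDl scalerAl.
have E1 (x y : L) : tlift (fun x1 x2 => tlift (fun y1 y2 => S (x1 * y1) * (x2 * y2))
    (comul y)) (comul x) = (counit x * counit y) *: 1 :> L.
  rewrite -counitM -antipodel comul_mul //.
  by split=> [v|u]; [apply: (linear_comp' (lmr _))|apply: lml].
have E2 (x y : L) : tlift (fun x1 x2 => tlift (fun y1 y2 => x1 * y1 * (S y2 * S x2))
    (comul y)) (comul x) = (counit x * counit y) *: 1 :> L.
  transitivity (tlift (fun x1 x2 => counit y *: (x1 * S x2)) (comul x)).
    apply: eq_tlift => x1 x2.
    transitivity (x1 * tlift (fun y1 y2 => y1 * S y2) (comul y) * S x2).
      rewrite (comp_tlift _ _ (lml x1)) (comp_tlift _ _ (lmr (S x2))).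
      by apply: eq_tlift => y1 y2; rewrite !mulrA.
    by rewrite antipoder -scalerAr mulr1 scalerAl.
  rewrite -(@comp_tlift _ _ _ _ _ (fun z : L => counit y *: z)).
    by rewrite antipoder scalerA mulrC.
  exact: linear_scale.
have Ea (f : L -> L) (x : L) : linear f -> f x = tlift (fun x1 x2 => counit x2 *: f x1 : L) (comul x).
  move=> lf; rewrite -{1}[x](counitr x) (comp_tlift _ _ lf).
  by apply: eq_tlift => u v; rewrite linear_Z.
have Eb (f : L -> L) (x : L) : linear f -> f x = tlift (fun x1 x2 => counit x1 *: f x2 : L) (comul x).
  move=> lf; rewrite -{1}[x](counitl x) (comp_tlift _ _ lf).
  by apply: eq_tlift => u v; rewrite linear_Z.
pose H x1 x2 x3 y1 y2 y3 := S (x1 * y1) * (x2 * y2) * (S y3 * S x3).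
transitivity (tlift (fun x1 x => tlift (fun y1 y => tlift (fun x2 x3 =>
   tlift (fun y2 y3 => H x1 x2 x3 y1 y2 y3) (comul y)) (comul x)) (comul b))
   (comul a)).
  rewrite -/S (Ea (fun a => S (a * b))); last by apply: linear_antipode; apply: linear_mulr.
  apply: eq_tlift => x1 x; rewrite (Ea (fun b => S (x1 * b))); last first.
    by apply: linear_antipode; apply: linear_mull.
  rewrite (@comp_tlift _ _ _ _ _ (fun z : L => counit x *: z)); last first.
    exact: linear_scale.
  apply: eq_tlift => y1 y; rewrite scalerA -[S _ in LHS]mulr1 scalerAr.
  rewrite -E2 (comp_tlift _ _ (lml _)); apply: eq_tlift => x2 x3.
  rewrite (comp_tlift _ _ (lml _)); apply: eq_tlift => y2 y3.
  by rewrite /H !mulrA.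
transitivity (tlift (fun x x3 => tlift (fun y y3 => tlift (fun x1 x2 =>
   tlift (fun y1 y2 => H x1 x2 x3 y1 y2 y3) (comul y)) (comul x)) (comul b))
   (comul a)).
  under eq_tlift do rewrite exchange_tlift.
  under [in RHS]eq_tlift do rewrite exchange_tlift.
  rewrite -(@comul_assoc _ (fun x1 x2 x3 => tlift (fun y1 y => tlift (fun y2 y3 =>
    H x1 x2 x3 y1 y2 y3) (comul y)) (comul b))).
  - apply: eq_tlift => x x3; apply: eq_tlift => x1 x2.
    rewrite -(@comul_assoc _ (fun y1 y2 y3 => H x1 x2 x3 y1 y2 y3)) // => u v.
    + by rewrite /H; do 2!apply: linear_mulr; apply: linear_antipode; apply: linear_mull.
    + by rewrite /H; apply: linear_mulr; do 2!apply: linear_mull.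
    + by rewrite /H; apply: linear_mull; apply: linear_mulr.
  - move=> y z; do 2!apply: tlift_fun_linear => ? ?.
    by rewrite /H; do 2!apply: linear_mulr; apply: linear_antipode; apply: linear_mulr.
  - move=> y z; do 2!apply: tlift_fun_linear => ? ?.
    by rewrite /H; apply: linear_mulr; apply: linear_mull; apply: linear_mulr.
  - move=> y z; do 2!apply: tlift_fun_linear => ? ?.
    by rewrite /H; do 2!apply: linear_mull.
rewrite -/S -[S b * S a]/((fun z => S b * S z) a) Eb; last by apply: linear_mull.
apply: eq_tlift => x x3; rewrite (Eb (fun z => S z * S x3)); last first.
  by apply: linear_mulr.
rewrite (@comp_tlift _ _ _ _ _ (fun z : L => counit x *: z)); last first.
  exact: linear_scale.
apply: eq_tlift => y y3; rewrite scalerA -[S y3 * _ in RHS]mul1r scalerAl -E1.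
rewrite (comp_tlift _ _ (lmr _)); apply: eq_tlift => x1 x2.
by rewrite (comp_tlift _ _ (lmr _)).
Qed.

End HopfTheory.

(* A finite dimensional left module on k^n: a acts on column vectors by
   v |-> mact a *m v. *)
Record module (k : fieldType) (L : falgType k) := Module {
  mdim : nat;
  mact :> L -> 'M[k]_mdim;
  mact_linear : linear mact;
  mact1 : mact 1 = 1%:M;
  mactM : forall a b, mact (a * b) = mact a *m mact b
}.

HB.instance Definition _ (k : fieldType) (L : falgType k) :=
  gen_eqMixin (module L).
HB.instance Definition _ (k : fieldType) (L : falgType k) :=
  gen_choiceMixin (module L).

Section Modules.
Context {k : fieldType} {L : falgType k}.
Implicit Types M N P : module L.

Definition is_hom M N (f : 'M[k]_(mdim N, mdim M)) :=
  forall a, f *m M a = N a *m f.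

Definition injmx m n (f : 'M[k]_(m, n)) :=
  forall v : 'cV_n, f *m v = 0 -> v = 0.

Definition surjmx m n (f : 'M[k]_(m, n)) :=
  forall w : 'cV_m, exists v : 'cV_n, f *m v = w.

Definition iso M N := exists (f : 'M[k]_(mdim N, mdim M)) g,
  [/\ is_hom f, g *m f = 1%:M & f *m g = 1%:M].

Definition short_exact M1 M2 M3 (f : 'M[k]_(mdim M2, mdim M1))
    (g : 'M[k]_(mdim M3, mdim M2)) :=
  [/\ is_hom f, is_hom g, injmx f, surjmx g &
      forall v : 'cV_(mdim M2),
        g *m v = 0 <-> exists u : 'cV_(mdim M1), v = f *m u].

Definition split_exact M1 M2 M3 :=
  exists (f : 'M[k]_(mdim M2, mdim M1)) (g : 'M[k]_(mdim M3, mdim M2)),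
    short_exact f g /\
    exists s : 'M[k]_(mdim M2, mdim M3), is_hom s /\ g *m s = 1%:M.

Definition submodule M (U : {vspace 'cV[k]_(mdim M)}) :=
  forall a v, v \in U -> M a *m v \in U.

Definition simple M :=
  mdim M != 0 /\ forall U, @submodule M U -> U = 0%VS \/ U = fullv.

Definition semisimple M :=
  forall U, @submodule M U ->
    exists W, [/\ @submodule M W, (U + W = fullv)%VS & (U :&: W = 0)%VS].

Definition projective P :=
  forall M N (g : 'M[k]_(mdim N, mdim M)) (f : 'M[k]_(mdim N, mdim P)),
    is_hom g -> surjmx g -> is_hom f -> exists h, @is_hom P M h /\ g *m h = f.

(* p is surjective with superfluous kernel. *)
Definition projective_cover P M :=
  projective P /\ exists p : 'M[k]_(mdim M, mdim P),
    [/\ is_hom p, surjmx p & forall U, @submodule P U ->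
          (forall w : 'cV_(mdim M), exists2 u, u \in U & p *m u = w) ->
          U = fullv].

End Modules.

Definition semisimple_alg (k : fieldType) (L : falgType k) :=
  forall M : module L, semisimple M.

(* As a k-algebra, End(M) is isomorphic to k exactly when it consists of the
   scalars. *)
Definition is_split (k : fieldType) (L : falgType k) :=
  forall M : module L, simple M ->
    forall f, @is_hom k L M M f -> exists c, f = c%:M.

Section IsoTheory.
Context {k : fieldType} {L : falgType k}.
Implicit Types M N P : module L.

Lemma is_hom_inv M N (f : 'M[k]_(mdim N, mdim M)) g :
  is_hom f -> g *m f = 1%:M -> f *m g = 1%:M -> is_hom g.
Proof.
move=> hf gf fg a; rewrite -[LHS]mulmx1 -fg -mulmxA (mulmxA (N a)) -hf.
by rewrite !mulmxA gf mul1mx.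
Qed.

Lemma is_hom1 M : is_hom (1%:M : 'M_(mdim M, mdim M)).
Proof. by move=> a; rewrite mul1mx mulmx1. Qed.

Lemma is_homM M N P (f : 'M[k]_(mdim N, mdim M)) (g : 'M[k]_(mdim P, mdim N)) :
  is_hom f -> is_hom g -> is_hom (g *m f).
Proof. by move=> hf hg a; rewrite -mulmxA hf !mulmxA hg. Qed.

Lemma iso_refl M : iso M M.
Proof. by exists 1%:M, 1%:M; split; rewrite ?mulmx1 //; apply: is_hom1. Qed.

Lemma iso_sym M N : iso M N -> iso N M.
Proof.
by move=> [f [g [hf gf fg]]]; exists g, f; split=> //; apply: (is_hom_inv hf).
Qed.

Lemma iso_trans M N P : iso M N -> iso N P -> iso M P.
Proof.
move=> [f [g [hf gf fg]]] [f' [g' [hf' gf' fg']]].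
exists (f' *m f), (g *m g'); split; first exact: is_homM.
  by rewrite -mulmxA (mulmxA g') gf' mul1mx.
by rewrite -mulmxA (mulmxA f) fg mul1mx.
Qed.

Lemma iso_cast M N (e : mdim M = mdim N) :
  (forall a, N a = castmx (e, e) (M a)) -> iso M N.
Proof.
case: M N e => m M M1 M2 M3 [n N N1 N2 N3] /= e; case: n / e N N1 N2 N3 => N N1 N2 N3.
move=> E; exists 1%:M, 1%:M; split; rewrite ?mulmx1 //.
by move=> a /=; rewrite mul1mx mulmx1 E castmx_id.
Qed.

Definition iso_rel M N := `[< iso M N >].

Lemma iso_rel_refl : reflexive iso_rel.
Proof. by move=> M; apply/asboolP/iso_refl. Qed.

Lemma iso_rel_sym : symmetric iso_rel.
Proof. by move=> M N; apply/asboolP/asboolP => /iso_sym. Qed.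

Lemma iso_rel_trans : transitive iso_rel.
Proof.
by move=> M N P /asboolP i /asboolP j; apply/asboolP/(iso_trans i).
Qed.

Canonical iso_equiv := EquivRel iso_rel iso_rel_refl iso_rel_sym iso_rel_trans.

Lemma iso_dim M N : iso M N -> mdim M = mdim N.
Proof.
suff H M' N' : iso M' N' -> (mdim M' <= mdim N')%N.
  by move=> i; apply/eqP; rewrite eqn_leq !H //; apply: iso_sym.
move=> [f [g [_ gf _]]].
by rewrite -[mdim M'](mxrank1 k) -gf mulmx_max_rank.
Qed.

Lemma simple_iso M N : iso M N -> simple M -> simple N.
Proof.
move=> [f [g [hf gf fg]]] [M0 sM].
have hg := is_hom_inv hf gf fg; split.
  by rewrite -(@iso_dim M N) //; exists f, g.
move=> U sU; pose F := linfun (mulmx f : 'cV[k]_(mdim M) -> 'cV_(mdim N)).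
have FE v : F v = f *m v by rewrite lfunE.
have sV : submodule (F @^-1: U)%VS.
  by move=> a v; rewrite -!memv_preim !FE mulmxA hf -mulmxA; apply: sU.
have mU u : u \in U -> g *m u \in (F @^-1: U)%VS.
  by rewrite -memv_preim FE mulmxA fg mul1mx.
case: (sM _ sV) => V0; [left|right].
  apply/eqP; rewrite -subv0; apply/subvP => u /mU; rewrite V0 !memv0 => /eqP gu.
  by rewrite -[u]mul1mx -fg -mulmxA gu mulmx0.
apply/eqP; rewrite eqEsubv subvf /=.
apply/subvP => u _; have: g *m u \in (F @^-1: U)%VS by rewrite V0 memvf.
by rewrite -memv_preim FE mulmxA fg mul1mx.
Qed.

Lemma simple_dim1 M : mdim M = 1 -> simple M.
Proof.
move=> M1; split; first by rewrite M1.
move=> U _; have [->|U0] := eqVneq U 0%VS; [by left|right].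
apply/eqP; rewrite eqEdim subvf /=.
by rewrite (@leq_trans 1) ?lt0n ?dimv_eq0 // dimvf /dim /= muln1 M1.
Qed.

Lemma schur M N (f : 'M[k]_(mdim N, mdim M)) :
  simple M -> simple N -> is_hom f -> f = 0 \/ iso M N.
Proof.
move=> [M0 sM] [N0 sN] hf.
pose F := linfun (mulmx f : 'cV[k]_(mdim M) -> 'cV_(mdim N)).
have FE v : F v = f *m v by rewrite lfunE.
have fz : (forall v : 'cV_(mdim M), f *m v = 0) -> f = 0.
  move=> f0; apply/matrixP => i j.
  by have /matrixP/(_ i 0) := f0 (delta_mx j 0); rewrite -colE !mxE.
have sK : submodule (lker F).
  by move=> a v; rewrite !memv_ker !FE mulmxA hf -mulmxA => /eqP ->; rewrite mulmx0.
have sI : submodule (limg F).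
  move=> a w /memv_imgP [v _ ->]; apply/memv_imgP; exists (M a *m v); first exact: memvf.
  by rewrite !FE !mulmxA hf.
case: (sM _ sK) => K0; last first.
  left; apply: fz => v; apply/eqP; rewrite -FE -memv_ker K0; exact: memvf.
case: (sN _ sI) => I0.
  left; apply: fz => v; apply/eqP; rewrite -FE -memv0 -I0; apply: memv_img.
  exact: memvf.
right; have kF : lker F == 0%VS by rewrite K0.
pose g : 'M[k]_(mdim M, mdim N) := \matrix_(i, j) (F^-1)%VF (delta_mx j 0) i 0.
have gE w : g *m w = (F^-1)%VF w.
  rewrite [w in RHS](matrix_sum_delta w) linear_sum /=.
  apply/matrixP => i j; rewrite mxE summxE; apply: eq_bigr => l _.
  by rewrite (ord1 j) big_ord1 linearZ !mxE mulrC.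
have gf : g *m f = 1%:M.
  apply/matrixP => i j; have /matrixP/(_ i 0) : g *m f *m delta_mx j 0 = delta_mx j 0 :> 'cV_(mdim M).
    by rewrite -mulmxA gE -FE lker0_lfunK.
  by rewrite -colE !mxE eqxx andbT => ->.
have fg : f *m g = 1%:M.
  apply/matrixP => i j; have /matrixP/(_ i 0) : f *m g *m delta_mx j 0 = delta_mx j 0 :> 'cV_(mdim N).
    by rewrite -mulmxA gE -FE limg_lfunVK // I0 memvf.
  by rewrite -colE !mxE eqxx andbT => ->.
by exists f, g.
Qed.

End IsoTheory.

Section TensorModules.
Context {k : fieldType} {L : hopfAlgType k}.
Implicit Types M N P : module L.

Lemma tensmxDl m n p q c (A A' : 'M[k]_(m, n)) (B : 'M[k]_(p, q)) :
  (c *: A + A') *t B = c *: (A *t B) + A' *t B.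
Proof. by apply/matrixP => i j; rewrite !mxE mulrDl mulrA. Qed.

Lemma tensmxDr m n p q c (A : 'M[k]_(m, n)) (B B' : 'M[k]_(p, q)) :
  A *t (c *: B + B') = c *: (A *t B) + A *t B'.
Proof. by apply/matrixP => i j; rewrite !mxE mulrDr mulrCA. Qed.

Lemma tensmx11 m n : (1%:M : 'M[k]_m) *t (1%:M : 'M[k]_n) = 1%:M.
Proof.
apply/matrixP => i j; case: (mxtens_indexP i) => i0 i1.
case: (mxtens_indexP j) => j0 j1; rewrite tensmxE !mxE -natrM mulnb.
by rewrite (can_eq (@mxtens_indexK _ _)) xpair_eqE.
Qed.

Lemma tensm_bilin M N : bilin (fun x y => M x *t N y).
Proof.
by split=> [v|u] c x y; rewrite mact_linear ?tensmxDl ?tensmxDr.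
Qed.

Definition tensm_act M N (a : L) : 'M[k]_(mdim M * mdim N) :=
  tlift (fun x y => M x *t N y) (comul a).

Lemma tensm_linear M N : linear (tensm_act M N).
Proof. exact: (linear_comp' (tlift_linear _) (@comul_is_linear _ _)). Qed.

Lemma tensm1 M N : tensm_act M N 1 = 1%:M.
Proof.
by rewrite /tensm_act comul1 (tlift_pure _ _ (tensm_bilin M N)) !mact1 tensmx11.
Qed.

Lemma linear_mulmxl m n p (A : 'M[k]_(m, n)) :
  linear (fun B : 'M[k]_(n, p) => A *m B).
Proof. by move=> c u v; rewrite linearP. Qed.

Lemma linear_mulmxr m n p (A : 'M[k]_(n, p)) :
  linear (fun B : 'M[k]_(m, n) => B *m A).
Proof. by move=> c u v; rewrite mulmxDl -scalemxAl. Qed.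

Lemma tensmM M N a b : tensm_act M N (a * b) = tensm_act M N a *m tensm_act M N b.
Proof.
rewrite /tensm_act (comul_mul _ _ (tensm_bilin M N)).
rewrite (comp_tlift _ _ (@linear_mulmxr _ _ _ (tlift _ (comul b)))).
apply: eq_tlift => x y; rewrite (comp_tlift _ _ (@linear_mulmxl _ _ _ _)).
by apply: eq_tlift => z w; rewrite !mactM tensmx_mul.
Qed.

Definition tensm M N : module L :=
  Module (tensm_linear M N) (tensm1 M N) (@tensmM M N).

Definition trivm_act (a : L) : 'M[k]_1 := (counit a)%:M.

Lemma trivm_linear : linear trivm_act.
Proof.
by move=> c x y; rewrite /trivm_act counit_is_scalar raddfD /= scale_scalar_mx.
Qed.

Lemma trivm1 : trivm_act 1 = 1%:M.
Proof. by rewrite /trivm_act counit1. Qed.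

Lemma trivmM a b : trivm_act (a * b) = trivm_act a *m trivm_act b.
Proof. by rewrite /trivm_act counitM scalar_mxM. Qed.

Definition trivm : module L := Module trivm_linear trivm1 trivmM.

Definition dualm_act M (a : L) : 'M[k]_(mdim M) := (M (antipode a))^T.

Lemma dualm_linear M : linear (dualm_act M).
Proof.
by move=> c x y; rewrite /dualm_act antipode_is_linear mact_linear linearP.
Qed.

Lemma dualm1 M : dualm_act M 1 = 1%:M.
Proof. by rewrite /dualm_act antipode1 mact1 trmx1. Qed.

Lemma dualmM M a b : dualm_act M (a * b) = dualm_act M a *m dualm_act M b.
Proof. by rewrite /dualm_act antipodeM mactM trmx_mul. Qed.

Definition dualm M : module L := Module (dualm_linear M) (dualm1 M) (@dualmM M).

Lemma is_hom_tens M N M' N' (f : 'M[k]_(mdim M', mdim M))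
    (g : 'M[k]_(mdim N', mdim N)) :
  is_hom f -> is_hom g -> @is_hom k L (tensm M N) (tensm M' N') (f *t g).
Proof.
move=> hf hg a; rewrite /= /tensm_act.
rewrite (comp_tlift _ _ (@linear_mulmxr _ _ _ _)) (comp_tlift _ _ (@linear_mulmxl _ _ _ _)).
by apply: eq_tlift => x y; rewrite !tensmx_mul hf hg.
Qed.

Lemma iso_tens M N M' N' : iso M M' -> iso N N' -> iso (tensm M N) (tensm M' N').
Proof.
move=> [f [g [hf gf fg]]] [f' [g' [hf' gf' fg']]].
exists (f *t f'), (g *t g'); split; first exact: is_hom_tens.
  by rewrite tensmx_mul gf gf' tensmx11.
by rewrite tensmx_mul fg fg' tensmx11.
Qed.

Lemma tensmxA m n p (A : 'M[k]_m) (B : 'M[k]_n) (C : 'M[k]_p) :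
  A *t B *t C = castmx (mulnA m n p, mulnA m n p) (A *t (B *t C)).
Proof.
apply/matrixP => i j; rewrite castmxE.
case: (mxtens_indexP i) => i' i3; case: (mxtens_indexP i') => i1 i2.
case: (mxtens_indexP j) => j' j3; case: (mxtens_indexP j') => j1 j2.
rewrite !tensmxE.
have E (u1 : 'I_m) (u2 : 'I_n) (u3 : 'I_p) :
    cast_ord (esym (mulnA m n p)) (mxtens_index (mxtens_index (u1, u2), u3)) =
    mxtens_index (u1, mxtens_index (u2, u3)).
  by apply: val_inj => /=; rewrite mulnDl -mulnA addnA.
by rewrite !E !tensmxE mulrA.
Qed.

Lemma linear_castmx m n m' n' (e : (m = m') * (n = n')) :
  linear (castmx e : 'M[k]_(m, n) -> 'M[k]_(m', n')).
Proof.
by move=> c x y; apply/matrixP => i j; rewrite !(castmxE, mxE).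
Qed.

Lemma iso_tensA M N P : iso (tensm M (tensm N P)) (tensm (tensm M N) P).
Proof.
apply: (@iso_cast k L (tensm M (tensm N P)) (tensm (tensm M N) P)
  (mulnA (mdim M) (mdim N) (mdim P))) => a /=.
rewrite /tensm_act (comp_tlift _ _ (@linear_castmx _ _ _ _ _)) /=.
under eq_tlift do rewrite /tensm_act.
transitivity (tlift (fun x z => tlift (fun x1 x2 => M x1 *t N x2 *t P z) (comul x))
   (comul a)).
  apply: eq_tlift => x z.
  rewrite (@comp_tlift _ _ _ _ _ (fun A : 'M_(mdim M * mdim N) => A *t P z)) //.
  by move=> c u v; rewrite tensmxDl.
rewrite (@comul_assoc _ _ _ (fun x y z => M x *t N y *t P z)).
- apply: eq_tlift => x y.
  transitivity (castmx (mulnA (mdim M) (mdim N) (mdim P), mulnA (mdim M) (mdim N) (mdim P))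
     (tlift (fun y1 y2 => M x *t (N y1 *t P y2)) (comul y))).
    rewrite (comp_tlift _ _ (@linear_castmx _ _ _ _ _)).
    by apply: eq_tlift => y1 y2; rewrite tensmxA.
  congr castmx; rewrite (@comp_tlift _ _ _ _ _ (fun A => M x *t A)) //.
  by move=> c u v; rewrite tensmxDr.
- by move=> y z c u v; rewrite mact_linear !tensmxDl.
- by move=> y z c u v; rewrite mact_linear tensmxDr !tensmxDl.
- by move=> y z c u v; rewrite mact_linear tensmxDr.
Qed.

Lemma iso_tens1m M : iso M (tensm trivm M).
Proof.
apply: (@iso_cast k L M (tensm trivm M) (esym (mul1n (mdim M)))) => a /=.
rewrite /tensm_act -{2}[a]counitl (comp_tlift _ _ (@mact_linear _ _ M)).
rewrite (comp_tlift _ _ (@linear_castmx _ _ _ _ _)); apply: eq_tlift => x y.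
by rewrite tens_scalar_mx (linear_Z _ _ (@mact_linear _ _ M)).
Qed.

Lemma iso_tensm1 M : iso M (tensm M trivm).
Proof.
apply: (@iso_cast k L M (tensm M trivm) (esym (muln1 (mdim M)))) => a /=.
rewrite /tensm_act -{2}[a]counitr (comp_tlift _ _ (@mact_linear _ _ M)).
rewrite (comp_tlift _ _ (@linear_castmx _ _ _ _ _)); apply: eq_tlift => x y.
by rewrite tens_mx_scalar (linear_Z _ _ (@mact_linear _ _ M)).
Qed.

Lemma iso_dual1 M : mdim M = 1 ->
  iso (tensm (dualm M) M) trivm /\ iso (tensm M (dualm M)) trivm.
Proof.
case: M => m M M1 M2 M3 /= e; subst m; set M0 := Module _ _ _.
pose chi a := M a 0 0.
have ME a : M a = (chi a)%:M by rewrite [LHS]mx11_scalar.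
have lchi : linear (chi : L -> k^o) by move=> c u v; rewrite /chi M1 !mxE.
have chiM a b : chi (a * b) = chi a * chi b.
  by rewrite /chi M3 ME [M b]ME -scalar_mxM !mxE.
have chi1 : chi 1 = 1 by rewrite /chi M2 mxE.
have chie a : chi (counit a *: 1) = counit a.
  by rewrite (linear_Z _ _ lchi) chi1 /GRing.scale /= mulr1.
have lsc : linear (fun c : k^o => c%:M : 'M[k]_(1 * 1)).
  by move=> c u v; rewrite raddfD /= scale_scalar_mx.
have t11 (c d : k) : (c%:M : 'M[k]_1) *t (d%:M : 'M[k]_1) = (c * d)%:M.
  by rewrite tens_scalar_mx scale_scalar_mx; apply/matrixP => i j; rewrite castmxE !mxE.
split.
  apply: (@iso_cast k L (tensm (dualm M0) M0) trivm (mul1n 1)) => a /=.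
  rewrite /trivm_act /tensm_act.
  rewrite -[in LHS]chie -antipodel (comp_tlift _ _ lchi) (comp_tlift _ _ lsc).
  rewrite (_ : mul1n 1 = erefl _) ?castmx_id; last exact: eq_irrelevance.
  by apply: eq_tlift => x y /=; rewrite /dualm_act /= chiM !ME tr_scalar_mx t11.
apply: (@iso_cast k L (tensm M0 (dualm M0)) trivm (mul1n 1)) => a /=.
rewrite /trivm_act /tensm_act.
rewrite -[in LHS]chie -antipoder (comp_tlift _ _ lchi) (comp_tlift _ _ lsc).
rewrite (_ : mul1n 1 = erefl _) ?castmx_id; last exact: eq_irrelevance.
by apply: eq_tlift => x y /=; rewrite /dualm_act /= chiM !ME tr_scalar_mx t11.
Qed.

End TensorModules.

Section SimpleModules.
Context {k : fieldType} (L : falgType k).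

Record simple_module := SimpleModule {
  smod :> module L;
  smodP : `[< simple smod >]
}.

HB.instance Definition _ := [isSub for smod].
HB.instance Definition _ := [Choice of simple_module by <:].

Definition siso_rel (S T : simple_module) := iso_rel S T.

Lemma siso_rel_refl : reflexive siso_rel.
Proof. by move=> S; apply: iso_rel_refl. Qed.

Lemma siso_rel_sym : symmetric siso_rel.
Proof. by move=> S T; apply: iso_rel_sym. Qed.

Lemma siso_rel_trans : transitive siso_rel.
Proof. by move=> S T U; apply: iso_rel_trans. Qed.

Canonical siso_equiv :=
  EquivRel siso_rel siso_rel_refl siso_rel_sym siso_rel_trans.

Definition simple_class : Type := {eq_quot siso_rel}%qT.
HB.instance Definition _ := Choice.on simple_class.
HB.instance Definition _ := EqQuotient.on simple_class.

Definition sclass (S : simple_module) : simple_class := \pi_simple_class%qT S.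

Lemma sclassP (S T : simple_module) : reflect (iso S T) (sclass S == sclass T).
Proof. by rewrite eqmodE; apply: asboolP. Qed.

(* M has a composition series with successive factors ss, from top to bottom. *)
Inductive comp_series : module L -> seq simple_module -> Prop :=
| CompNil M : mdim M = 0 -> comp_series M [::]
| CompCons (N M : module L) (S : simple_module) f g ss :
    @short_exact k L N M S f g -> comp_series N ss -> comp_series M (S :: ss).

End SimpleModules.

Section CompSeries.
Context {k : fieldType} {L : falgType k}.
Implicit Types M N Q : module L.

Lemma mulmx_ext m n (A B : 'M[k]_(m, n)) :
  (forall v : 'cV_n, A *m v = B *m v) -> A = B.
Proof.
move=> e; apply/matrixP => i j.
by have /matrixP/(_ i 0) := e (delta_mx j 0); rewrite -!colE !mxE.
Qed.

Lemma surjmx_section m n (g : 'M[k]_(m, n)) :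
  surjmx g -> exists h, g *m h = 1%:M.
Proof.
move=> sg; exists (\matrix_(i, j) sval (cid (sg (delta_mx j 0))) i 0).
apply/matrixP => i j; have /matrixP/(_ i 0) := svalP (cid (sg (delta_mx j 0))).
rewrite !mxE eqxx andbT => <-; apply: eq_bigr => l _; by rewrite !mxE.
Qed.

Definition vspace_in m (U : {vspace 'cV[k]_m}) : 'M[k]_(m, \dim U) :=
  \matrix_(i, j) (vbasis U)`_j i 0.

Definition vspace_out m (U : {vspace 'cV[k]_m}) (p : 'End('cV[k]_m)) :
    'M[k]_(\dim U, m) :=
  \matrix_(i, j) coord (vbasis U) i (p (delta_mx j 0)).

Lemma vspace_inE m (U : {vspace 'cV[k]_m}) v :
  vspace_in U *m v = \sum_j v j 0 *: (vbasis U)`_j.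
Proof.
apply/matrixP => i j; rewrite !mxE summxE; apply: eq_bigr => l _.
by rewrite !mxE !ord1 mulrC.
Qed.

Lemma vspace_outE m (U : {vspace 'cV[k]_m}) p v :
  vspace_out U p *m v = \col_i coord (vbasis U) i (p v).
Proof.
apply/matrixP => i j; rewrite !mxE.
have {2}-> : v = \sum_l v l 0 *: delta_mx l 0.
  by rewrite [LHS]matrix_sum_delta; apply: eq_bigr => l _; rewrite big_ord1.
rewrite !linear_sum; apply: eq_bigr => l _.
by rewrite !linearZ mxE !ord1 mulrC.
Qed.

Lemma vspace_in_mem m (U : {vspace 'cV[k]_m}) v : vspace_in U *m v \in U.
Proof.
rewrite vspace_inE; apply: memv_suml => j _; apply: memvZ; apply: vbasis_mem.
by rewrite mem_nth // size_tuple.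
Qed.

Lemma vspace_inout m (U : {vspace 'cV[k]_m}) (p : 'End('cV[k]_m)) v :
  p v \in U -> vspace_in U *m (vspace_out U p *m v) = p v.
Proof.
move=> pv; rewrite vspace_outE vspace_inE [RHS](coord_vbasis pv).
by apply: eq_bigr => i _; rewrite mxE.
Qed.

Lemma vspace_outin m (U : {vspace 'cV[k]_m}) (p : 'End('cV[k]_m)) :
  {in U, forall v, p v = v} -> vspace_out U p *m vspace_in U = 1%:M.
Proof.
move=> pU; apply: mulmx_ext => v; rewrite mul1mx -mulmxA vspace_outE.
apply/matrixP => i j; rewrite mxE pU ?vspace_in_mem // vspace_inE ord1.
by rewrite coord_sum_free // (basis_free (vbasisP U)).
Qed.

(* A submodule U of M yields a short exact sequence 0 -> U -> M -> M/U -> 0. *)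
Lemma submodule_exact M U : @submodule k L M U ->
  exists N Q f g, [/\ @short_exact k L N M Q f g, mdim N = \dim U,
    mdim Q = (mdim M - \dim U)%N & forall v, (g *m v == 0) = (v \in U)].
Proof.
move=> sU; pose W := (U^C)%VS.
have dUW : (U :&: W = 0)%VS by apply: capv_compl.
have dWU : (W :&: U = 0)%VS by rewrite capvC.
have UW v : v \in (U + W)%VS by rewrite addv_complf memvf.
pose p := daddv_pi U W; pose q := daddv_pi W U.
pose f := vspace_in U; pose r := vspace_out U p.
pose h := vspace_in W; pose g := vspace_out W q.
have pU : {in U, forall v, p v = v} by move=> v; apply: daddv_pi_id.
have qW : {in W, forall v, q v = v} by move=> v; apply: daddv_pi_id.
have pq v : p v + q v = v by apply: daddv_pi_add.
have rf : r *m f = 1%:M by apply: vspace_outin.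
have gh : g *m h = 1%:M by apply: vspace_outin.
have fr v : f *m (r *m v) = p v by apply: vspace_inout; apply: memv_pi.
have hg v : h *m (g *m v) = q v by apply: vspace_inout; apply: memv_pi.
have E : f *m r + h *m g = 1%:M.
  by apply: mulmx_ext => v; rewrite mulmxDl -!mulmxA fr hg pq mul1mx.
have gU v : v \in U -> g *m v = 0.
  move=> vU; have: q v = 0.
    by apply: (addrI (p v)); rewrite pq addr0 pU.
  by move=> q0; rewrite -[g]mul1mx -gh -!mulmxA hg q0 mulmx0.
have gUE v : (g *m v == 0) = (v \in U).
  apply/eqP/idP; last exact: gU.
  move=> gv; rewrite -(pq v) -hg gv mulmx0 addr0 -fr; exact: vspace_in_mem.
have gMf a : g *m M a *m f = 0.
  apply: mulmx_ext => v; rewrite mul0mx -!mulmxA; apply: gU; apply: sU.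
  exact: vspace_in_mem.
have gM a : g *m M a = g *m M a *m h *m g.
  by rewrite -[LHS]mulmx1 -E mulmxDr !mulmxA gMf mul0mx add0r.
have Mf a : M a *m f = f *m (r *m M a *m f).
  rewrite -[LHS]mul1mx -E mulmxDl -!mulmxA (mulmxA g) gMf mulmx0 addr0 //.
pose nact (a : L) := r *m M a *m f.
pose qact (a : L) := g *m M a *m h.
have n1 : linear nact.
  by move=> c x y; rewrite /nact mact_linear mulmxDr mulmxDl -scalemxAr -scalemxAl.
have n2 : nact 1 = 1%:M by rewrite /nact mact1 mulmx1.
have n3 a b : nact (a * b) = nact a *m nact b.
  by rewrite /nact mactM -!mulmxA [in LHS]Mf !mulmxA.
have q1 : linear qact.
  by move=> c x y; rewrite /qact mact_linear mulmxDr mulmxDl -scalemxAr -scalemxAl.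
have q2 : qact 1 = 1%:M by rewrite /qact mact1 mulmx1.
have q3 a b : qact (a * b) = qact a *m qact b.
  by rewrite /qact mactM mulmxA [in LHS]gM !mulmxA.
exists (Module n1 n2 n3), (Module q1 q2 q3), f, g; split=> //=; last first.
  by rewrite dimv_compl dimvf /dim /= muln1.
split.
- by move=> a /=; rewrite Mf.
- by move=> a /=; rewrite gM.
- by move=> v fv; rewrite -[v]mul1mx -rf -mulmxA fv mulmx0.
- by move=> w; exists (h *m w); rewrite mulmxA gh mul1mx.
move=> v; split=> [/eqP|[u ->]]; last by apply: gU; apply: vspace_in_mem.
by rewrite gUE => vU; exists (r *m v); rewrite fr pU.
Qed.

Lemma comp_series_exists M : exists ss, comp_series M ss.
Proof.
have [n] := ubnP (mdim M); elim: n M => // n IHn M; rewrite ltnS => Mn.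
have [M0|M0] := eqVneq (mdim M) 0; first by exists [::]; constructor.
pose P d := `[< exists U, [/\ @submodule k L M U, U != fullv & \dim U = d] >].
have exP : exists d, P d.
  exists 0; apply/asboolP; exists 0%VS; rewrite dimv0; split=> //.
    by move=> a v; rewrite !memv0 => /eqP ->; rewrite mulmx0.
  by apply: contra_neq M0 => e; have := dimv0 'cV[k]_(mdim M);
    rewrite e dimvf /dim /= muln1.
have bP d : P d -> (d <= mdim M)%N.
  move=> /asboolP [U [_ _ <-]]; have := dimvS (subvf U).
  by rewrite dimvf /dim /= muln1.
case: (ex_maxnP exP bP) => d /asboolP [U [sU Uf dU]] dmax.
have [N [Q [f [g [ex dN dQ gU]]]]] := submodule_exact sU.
have [hf hg injf surjg exfg] := ex.
have Ulf : (\dim U < mdim M)%N.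
  rewrite ltn_neqAle bP ?andbT; last by apply/asboolP; exists U.
  by apply: contraNneq Uf => e; rewrite eqEdim subvf dimvf /dim /= muln1 e.
have [ss cN] : exists ss, comp_series N ss.
  by apply: IHn; rewrite dN; apply: leq_trans Mn.
have sQ : simple Q.
  split; first by rewrite dQ subn_eq0 -ltnNge.
  move=> V sV; pose G := linfun (mulmx g : 'cV[k]_(mdim M) -> 'cV_(mdim Q)).
  have GE v : G v = g *m v by rewrite lfunE.
  have sG : submodule (G @^-1: V)%VS.
    by move=> a v; rewrite -!memv_preim !GE mulmxA hg -mulmxA; apply: sV.
  have [Gf|Gf] := eqVneq (G @^-1: V)%VS fullv.
    right; apply/eqP; rewrite eqEsubv subvf; apply/subvP => w _.
    have [v <-] := surjg w; have: v \in (G @^-1: V)%VS by rewrite Gf memvf.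
    by rewrite -memv_preim GE.
  left; apply/eqP; rewrite -subv0; apply/subvP => w wV.
  have [v gv] := surjg w; rewrite memv0 -gv gU.
  have UG : (U <= G @^-1: V)%VS.
    by apply/subvP => u; rewrite -gU -memv_preim GE => /eqP ->; rewrite mem0v.
  have /eqP -> : U == (G @^-1: V)%VS.
    rewrite eqEdim UG /= dU; apply: dmax; apply/asboolP.
    by exists (G @^-1: V)%VS.
  by rewrite -memv_preim GE gv.
exists (SimpleModule (asboolT sQ) :: ss).
exact: (@CompCons _ _ _ _ (SimpleModule (asboolT sQ)) f g).
Qed.

Definition comp_factors M : seq (simple_module L) :=
  sval (cid (comp_series_exists M)).

(* The sum of the composition factors of M with multiplicity; by the
   Jordan-Hoelder theorem it does not depend on the series chosen. *)
Definition bar M : {malg int[simple_class L]} :=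
  \sum_(S <- comp_factors M) << sclass S >>.

End CompSeries.

(* The integral monoid ring of G; it is the integral group ring when G is a
   group.  (The ring structure of {malg R[G]} in multinomials needs a monoid
   without nontrivial units, so it is rebuilt here.) *)
Definition monoid_ring (G : monoidType) : Type := {malg int[G]}.

Section MonoidRing.
Context {G : monoidType}.
Implicit Types g : {malg int[G]}.

HB.instance Definition _ := GRing.Zmodule.on (monoid_ring G).

Definition mr_one : monoid_ring G := << 1%g : G >>.

Definition mr_mul (g1 g2 : monoid_ring G) : monoid_ring G :=
  \sum_(k1 <- msupp g1) \sum_(k2 <- msupp g2)
    << mcoeff k1 g1 * mcoeff k2 g2 *g (k1 * k2)%g >>.

Local Notation "g1 *M_[ k1 , k2 ] g2" :=
  << mcoeff k1%g g1 * mcoeff k2%g g2 *g (k1 * k2)%g >>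
  (at level 40, no associativity).

Fact mr_mullw (d1 d2 : {fset G}) g1 g2 :
  (msupp g1 `<=` d1)%fset -> (msupp g2 `<=` d2)%fset ->
  mr_mul g1 g2 = \sum_(k1 <- d1) \sum_(k2 <- d2) g1 *M_[k1, k2] g2.
Proof.
move=> le_d1 le_d2; rewrite /mr_mul (big_fset_incl _ le_d1) /=.
  apply/eq_bigr=> k1 _; apply/big_fset_incl => // k _ /mcoeff_outdom ->.
  by rewrite mulr0 monalgU0.
move=> k _ /mcoeff_outdom g1k.
by rewrite big1 => // k' _; rewrite g1k mul0r monalgU0.
Qed.

Fact mr_mul0g : left_zero 0 mr_mul.
Proof. by move=> g; rewrite /mr_mul msupp0 big_seq_fset0. Qed.

Fact mr_mulg0 : right_zero 0 mr_mul.
Proof.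
by move=> g; rewrite /mr_mul; apply: big1 => k _; rewrite msupp0 big_seq_fset0.
Qed.

Fact mr_mulUU c1 c2 (k1 k2 : G) :
  mr_mul << c1 *g k1 >> << c2 *g k2 >> = << c1 * c2 *g (k1 * k2)%g >>.
Proof. by rewrite (mr_mullw msuppU_le msuppU_le) !big_seq_fset1 !mcoeffUU. Qed.

Fact mr_mulDl : left_distributive mr_mul +%R.
Proof.
move=> g1 g2 g.
rewrite [in RHS](mr_mullw (fsubsetUl _ (msupp g2)) (fsubset_refl _)).
rewrite [in RHS](mr_mullw (fsubsetUr (msupp g1) _) (fsubset_refl _)).
rewrite (mr_mullw (msuppD_le _ _) (fsubset_refl _)) -big_split /=.
apply/eq_bigr=> k1 _; rewrite -big_split /=; apply/eq_bigr=> k2 _.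
by rewrite mcoeffD mulrDl monalgUD.
Qed.

Fact mr_mulDr : right_distributive mr_mul +%R.
Proof.
move=> g g1 g2.
rewrite [in RHS](mr_mullw (fsubset_refl _) (fsubsetUl _ (msupp g2))).
rewrite [in RHS](mr_mullw (fsubset_refl _) (fsubsetUr (msupp g1) _)).
rewrite (mr_mullw (fsubset_refl _) (msuppD_le _ _)) -big_split /=.
apply/eq_bigr=> k1 _; rewrite -big_split /=; apply/eq_bigr=> k2 _.
by rewrite mcoeffD mulrDr monalgUD.
Qed.

Fact mr_suml I (r : seq I) (F : I -> monoid_ring G) g :
  mr_mul (\sum_(i <- r) F i) g = \sum_(i <- r) mr_mul (F i) g.
Proof. exact: (big_morph (mr_mul^~ g) (fun _ _ => mr_mulDl _ _ _) (mr_mul0g _)). Qed.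

Fact mr_sumr I (r : seq I) (F : I -> monoid_ring G) g :
  mr_mul g (\sum_(i <- r) F i) = \sum_(i <- r) mr_mul g (F i).
Proof. exact: (big_morph (mr_mul g) (fun _ _ => mr_mulDr _ _ _) (mr_mulg0 _)). Qed.

Fact mr_mul1g : left_id mr_one mr_mul.
Proof.
move=> g; rewrite [g in LHS]monalgE mr_sumr [RHS]monalgE.
by apply: eq_bigr => k _; rewrite mr_mulUU mul1r mul1g.
Qed.

Fact mr_mulg1 : right_id mr_one mr_mul.
Proof.
move=> g; rewrite [g in LHS]monalgE mr_suml [RHS]monalgE.
by apply: eq_bigr => k _; rewrite mr_mulUU mulr1 mulg1.
Qed.

Fact mr_mulA : associative mr_mul.
Proof.
move=> g1 g2 g3; rewrite [g1]monalgE [in LHS]mr_suml (mr_suml _ _ g2).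
rewrite (mr_suml _ _ g3); apply: eq_bigr => k1 _.
rewrite [g2]monalgE (mr_suml _ _ g3) !(mr_sumr _ _ << _ *g k1 >>).
rewrite (mr_suml _ _ g3); apply: eq_bigr => k2 _.
rewrite [g3]monalgE (mr_sumr _ _ << _ *g k2 >>) !mr_sumr.
by apply: eq_bigr => k3 _; rewrite !mr_mulUU mulrA mulgA.
Qed.

HB.instance Definition _ := GRing.Zmodule_isPzRing.Build (monoid_ring G)
  mr_mulA mr_mul1g mr_mulg1 mr_mulDl mr_mulDr.

Lemma monoid_ringU (c1 c2 : int) (k1 k2 : G) :
  (<< c1 *g k1 >> : monoid_ring G) * (<< c2 *g k2 >> : monoid_ring G) =
  << c1 * c2 *g (k1 * k2)%g >>.
Proof. exact: mr_mulUU. Qed.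

End MonoidRing.

Section IsoClass.
Context {k : fieldType} (L : hopfAlgType k).

(* Isomorphism classes of modules, a monoid under the tensor product. *)
Definition iso_class : Type := {eq_quot @iso_rel k L}%qT.
HB.instance Definition _ := Choice.on iso_class.
HB.instance Definition _ := EqQuotient.on iso_class.

Definition mclass (M : module L) : iso_class := \pi_iso_class%qT M.

Lemma mclassP (M N : module L) : reflect (iso M N) (mclass M == mclass N).
Proof. by rewrite eqmodE; apply: asboolP. Qed.

Lemma mclassW (P : iso_class -> Prop) : (forall M, P (mclass M)) -> forall x, P x.
Proof. by move=> h; elim/quotW. Qed.

Definition iso_class_mul (x y : iso_class) := mclass (tensm (repr x) (repr y)).

Lemma iso_class_mulE (M N : module L) : iso_class_mul (mclass M) (mclass N) = mclass (tensm M N).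
Proof. by apply/eqP/mclassP/iso_tens; apply/mclassP; rewrite /mclass reprK. Qed.

Fact iso_class_mulA : associative iso_class_mul.
Proof.
elim/mclassW=> M; elim/mclassW=> N; elim/mclassW=> P; rewrite !iso_class_mulE.
exact/eqP/mclassP/iso_tensA.
Qed.

Fact iso_class_mul1 : left_id (mclass trivm) iso_class_mul.
Proof.
elim/mclassW=> M; rewrite iso_class_mulE; apply/eqP/mclassP/iso_sym.
exact: iso_tens1m.
Qed.

Fact iso_class_mulr1 : right_id (mclass trivm) iso_class_mul.
Proof.
elim/mclassW=> M; rewrite iso_class_mulE; apply/eqP/mclassP/iso_sym.
exact: iso_tensm1.
Qed.

HB.instance Definition _ := isMonoid.Build iso_class
  iso_class_mulA iso_class_mul1 iso_class_mulr1.

Lemma mclassM (M N : module L) :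
  (mclass M * mclass N)%g = mclass (tensm M N).
Proof. exact: iso_class_mulE. Qed.

Definition split_rel (x : monoid_ring iso_class) := exists M1 M2 M3 : module L,
  split_exact M1 M2 M3 /\
  x = << mclass M2 >> - (<< mclass M1 >> + << mclass M3 >>).

(* The subgroup generated by split_rel, as an intersection of subgroups. *)
Definition split_relations : pred (monoid_ring iso_class) := fun x =>
  `[< forall A : zmodClosed (monoid_ring iso_class),
        (forall y, split_rel y -> y \in A) -> x \in A >].

Fact split_relations_zmod : zmod_closed split_relations.
Proof.
split=> [|x y /asboolP hx /asboolP hy]; apply/asboolP=> A hA.
  exact: rpred0.
by rewrite rpredB ?hx ?hy.
Qed.

HB.instance Definition _ := GRing.isZmodClosed.Build (monoid_ring iso_class)
  split_relations split_relations_zmod.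

Lemma split_relations_ind (P : monoid_ring iso_class -> Prop) :
  (forall x, split_rel x -> P x) -> P 0 -> (forall x y, P x -> P y -> P (x - y)) ->
  forall x, x \in split_relations -> P x.
Proof.
move=> Prel P0 PB x /asboolP hx; pose A : pred (monoid_ring iso_class) := fun x => `[< P x >].
have zA : zmod_closed A.
  split=> [|u v /asboolP hu /asboolP hv]; apply/asboolP => //; exact: PB.
pose B := GRing.isZmodClosed.Build _ A zA.
pose A' : zmodClosed (monoid_ring iso_class) := HB.pack A B.
by apply/asboolP; apply: (hx A') => y hy; apply/asboolP/Prel.
Qed.

Lemma split_rel_in x : split_rel x -> x \in split_relations.
Proof. by move=> hx; apply/asboolP => A; apply. Qed.

Lemma split_exactP (M1 M2 M3 : module L) : split_exact M1 M2 M3 <->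
  exists (f : 'M[k]_(mdim M2, mdim M1)) (g : 'M[k]_(mdim M3, mdim M2)) r s,
    [/\ is_hom f, is_hom g, @is_hom k L M2 M1 r, @is_hom k L M3 M2 s &
        [/\ r *m f = 1%:M, g *m s = 1%:M & f *m r + s *m g = 1%:M]].
Proof.
split=> [[f [g [[hf hg injf surjg exfg] [s [hs gs]]]]]|]; last first.
  move=> [f [g [r [s [hf hg hr hs [rf gs E]]]]]].
  have gf : g *m f = 0.
    have gfr : g *m f *m r = 0.
      apply: (addIr g); rewrite add0r -[RHS]mulmx1 -E mulmxDr !mulmxA gs.
      by rewrite mul1mx.
    by rewrite -[g *m f]mulmx1 -rf mulmxA gfr mul0mx.
  exists f, g; split; last by exists s.
  split=> //.
  - by move=> v fv; rewrite -[v]mul1mx -rf -mulmxA fv mulmx0.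
  - by move=> w; exists (s *m w); rewrite mulmxA gs mul1mx.
  move=> v; split=> [gv|[u ->]]; last by rewrite mulmxA gf mul0mx.
  by exists (r *m v); rewrite -[LHS]mul1mx -E mulmxDl -!mulmxA gv mulmx0 addr0.
have gf : g *m f = 0.
  by apply: mulmx_ext => v; rewrite mul0mx -mulmxA; apply: (exfg _).2; exists v.
have ker (v : 'cV_(mdim M2)) : exists u, (1%:M - s *m g) *m v = f *m u.
  apply: (exfg _).1; rewrite mulmxA mulmxBr mulmx1 mulmxA gs mul1mx subrr.
  by rewrite mul0mx.
have [c cE] := boolp.choice (fun j => ker (delta_mx j 0)).
pose r : 'M[k]_(mdim M1, mdim M2) := \matrix_(i, j) c j i 0.
have fr : f *m r = 1%:M - s *m g.
  apply/matrixP => i j; have /matrixP/(_ i 0) := cE j.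
  by rewrite -colE mxE => ->; rewrite !mxE; apply: eq_bigr => l _; rewrite !mxE.
have finj m (A B : 'M_(_, m)) : f *m A = f *m B -> A = B.
  move=> e; apply: mulmx_ext => v; apply/eqP; rewrite -subr_eq0 -mulmxBl; apply/eqP.
  by apply: injf; rewrite mulmxA mulmxBr e subrr mul0mx.
exists f, g, r, s; split=> //.
  move=> a; apply: finj; rewrite !mulmxA hf -[_ *m f *m r]mulmxA fr.
  by rewrite mulmxBl mulmxBr mul1mx mulmx1 -(mulmxA s) hg !mulmxA hs.
split=> //; last by rewrite fr subrK.
by apply: finj; rewrite mulmxA fr mulmxBl -mulmxA gf mulmx0 subr0 mul1mx mulmx1.
Qed.

Lemma split_exact_tensl (N M1 M2 M3 : module L) :
  split_exact M1 M2 M3 -> split_exact (tensm N M1) (tensm N M2) (tensm N M3).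
Proof.
move=> /split_exactP [f [g [r [s [hf hg hr hs [rf gs E]]]]]]; apply/split_exactP.
exists (1%:M *t f), (1%:M *t g), (1%:M *t r), (1%:M *t s).
have h1 := @is_hom1 _ _ N.
split; [exact: is_hom_tens.. |].
rewrite !tensmx_mul rf gs !mulmx1 !tensmx11; split=> //.
by rewrite -[X in X + _]scale1r -tensmxDr scale1r E tensmx11.
Qed.

Lemma split_exact_tensr (N M1 M2 M3 : module L) :
  split_exact M1 M2 M3 -> split_exact (tensm M1 N) (tensm M2 N) (tensm M3 N).
Proof.
move=> /split_exactP [f [g [r [s [hf hg hr hs [rf gs E]]]]]]; apply/split_exactP.
exists (f *t 1%:M), (g *t 1%:M), (r *t 1%:M), (s *t 1%:M).
have h1 := @is_hom1 _ _ N.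
split; [exact: is_hom_tens.. |].
rewrite !tensmx_mul rf gs !mulmx1 !tensmx11; split=> //.
by rewrite -[X in X + _]scale1r -tensmxDl scale1r E tensmx11.
Qed.

Lemma monoid_ring_ind (G : monoidType) (P : monoid_ring G -> Prop) :
  P 0 -> (forall x y, P x -> P y -> P (x - y)) -> (forall g : G, P << g >>) ->
  forall x, P x.
Proof.
move=> P0 PB PU.
have PN x : P x -> P (- x) by rewrite -sub0r; apply: PB.
have PD x y : P x -> P y -> P (x + y).
  by move=> hx hy; rewrite -[y]opprK; apply: PB => //; apply: PN.
move=> x; rewrite [x]monalgE; elim/big_rec: _ => // g y _; apply: (PD _ _).
have Pn n : P << n%:Z *g g >>.
  elim: n => [|n IHn]; first by rewrite monalgU0.
  by rewrite intS monalgUD; apply: (PD _ _).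
case: (mcoeff g x) => n //; rewrite NegzE monalgUN; exact: PN.
Qed.

Fact split_relationsMl u x : x \in split_relations -> u * x \in split_relations.
Proof.
move: u x; apply: monoid_ring_ind => [|u v hu hv|U] x hx.
- by rewrite mul0r rpred0.
- by rewrite mulrBl rpredB ?hu ?hv.
move: x hx; apply: split_relations_ind => [x||x y].
- move=> [M1 [M2 [M3 [ex ->]]]].
  elim/mclassW: U => U; rewrite mulrBr mulrDr !monoid_ringU !mulr1 !mclassM.
  apply: split_rel_in; exists (tensm U M1), (tensm U M2), (tensm U M3).
  by split=> //; apply: split_exact_tensl.
- by rewrite mulr0 rpred0.
- by move=> hx hy; rewrite mulrBr rpredB.
Qed.

Fact split_relationsMr u x : x \in split_relations -> x * u \in split_relations.
Proof.
move: u x; apply: monoid_ring_ind => [|u v hu hv|U] x hx.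
- by rewrite mulr0 rpred0.
- by rewrite mulrBr rpredB ?hu ?hv.
move: x hx; apply: split_relations_ind => [x||x y].
- move=> [M1 [M2 [M3 [ex ->]]]].
  elim/mclassW: U => U; rewrite mulrBl mulrDl !monoid_ringU !mulr1 !mclassM.
  apply: split_rel_in; exists (tensm M1 U), (tensm M2 U), (tensm M3 U).
  by split=> //; apply: split_exact_tensr.
- by rewrite mul0r rpred0.
- by move=> hx hy; rewrite mulrBl rpredB.
Qed.

(* The free abelian group on iso_class modulo the split exact sequences. *)
Definition K0 : Type :=
  Quotient.quot (GRing.ZmodClosed.clone _ split_relations _).
HB.instance Definition _ := GRing.Zmodule.on K0.
HB.instance Definition _ := EqQuotient.on K0.

Definition K0_of (x : monoid_ring iso_class) : K0 := \pi_K0%qT x.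

Lemma K0_ofP x y : (K0_of x == K0_of y) = (x - y \in split_relations).
Proof. by rewrite eqmodE. Qed.

Lemma K0_ofB : {morph K0_of : x y / x - y}.
Proof. by move=> x y; rewrite /K0_of; rewrite !piE. Qed.

Definition K0_one : K0 := K0_of 1.
Definition K0_mul (x y : K0) : K0 := K0_of (repr x * repr y).

Lemma K0_mulE x y : K0_mul (K0_of x) (K0_of y) = K0_of (x * y).
Proof.
have E z : repr (K0_of z) - z \in split_relations.
  by rewrite -K0_ofP /K0_of reprK.
apply/eqP; rewrite K0_ofP.
rewrite -[_ - _](subrKA (repr (K0_of x) * y)) -mulrBr -mulrBl.
by apply: rpredD; [apply: split_relationsMl | apply: split_relationsMr].
Qed.

Lemma K0_ofW (P : K0 -> Prop) : (forall x, P (K0_of x)) -> forall x, P x.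
Proof. by move=> h; elim/quotW. Qed.

Lemma K0_ofD : {morph K0_of : x y / x + y}.
Proof. by move=> x y; rewrite /K0_of !piE. Qed.

Fact K0_mulA : associative K0_mul.
Proof.
elim/K0_ofW=> x; elim/K0_ofW=> y; elim/K0_ofW=> z.
by rewrite !K0_mulE mulrA.
Qed.

Fact K0_mul1 : left_id K0_one K0_mul.
Proof. by elim/K0_ofW=> x; rewrite K0_mulE mul1r. Qed.

Fact K0_mulr1 : right_id K0_one K0_mul.
Proof. by elim/K0_ofW=> x; rewrite K0_mulE mulr1. Qed.

Fact K0_mulDl : left_distributive K0_mul +%R.
Proof.
elim/K0_ofW=> x; elim/K0_ofW=> y; elim/K0_ofW=> z.
by rewrite -K0_ofD !K0_mulE mulrDl K0_ofD.
Qed.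

Fact K0_mulDr : right_distributive K0_mul +%R.
Proof.
elim/K0_ofW=> x; elim/K0_ofW=> y; elim/K0_ofW=> z.
by rewrite -K0_ofD !K0_mulE mulrDr K0_ofD.
Qed.

HB.instance Definition _ := GRing.Zmodule_isPzRing.Build K0
  K0_mulA K0_mul1 K0_mulr1 K0_mulDl K0_mulDr.

Definition K0_class (M : module L) : K0 := K0_of << mclass M >>.

(* The subring generated by the classes of projective and of semisimple
   modules, as an intersection of subrings. *)
Definition K0p_pred : pred K0 := fun x =>
  `[< forall A : subringClosed K0,
        (forall M : module L, projective M \/ semisimple M ->
          K0_class M \in A) -> x \in A >].

Fact K0p_subring : subring_closed K0p_pred.
Proof.
split=> [|x y /asboolP hx /asboolP hy|x y /asboolP hx /asboolP hy];
  apply/asboolP=> A hA; first exact: rpred1.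
  by rewrite rpredB ?hx ?hy.
by rewrite rpredM ?hx ?hy.
Qed.

HB.instance Definition _ := GRing.isSubringClosed.Build K0 K0p_pred K0p_subring.

Record K0p := K0pElt { K0p_val :> K0; K0p_valP : K0p_val \in K0p_pred }.

HB.instance Definition _ := [isSub for K0p_val].
HB.instance Definition _ := [Choice of K0p by <:].
HB.instance Definition _ := GRing.SubChoice_isSubPzRing.Build K0 K0p_pred K0p
  K0p_subring.

End IsoClass.

Section Basic.
Context {k : fieldType} (L : falgType k).

(* p : L -> Q is a surjective homomorphism of left modules whose kernel is the
   Jacobson radical (the common annihilator of the simple modules): Q is the
   maximal semisimple quotient algebra, seen as a left module. *)
Definition max_semisimple_quotient (Q : module L) (p : L -> 'cV[k]_(mdim Q)) :=
  [/\ linear p, forall a b, p (a * b) = Q a *m p b, forall v, exists a, p a = v &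
      forall a, p a = 0 <-> forall S : module L, simple S -> S a = 0].

Definition is_basic := exists (Q : module L) (p : L -> 'cV[k]_(mdim Q)),
  max_semisimple_quotient p /\
  forall S : simple_module L, mcoeff (sclass S) (bar Q) = 1.

Lemma mcoeff_bar M (S : simple_module L) : mcoeff (sclass S) (bar M) =
  (count (fun T : simple_module L => iso_rel T S) (comp_factors M))%:R.
Proof.
rewrite /bar raddf_sum /=; elim: comp_factors => [|T ss IH].
  by rewrite big_nil.
rewrite big_cons /= IH natrD; congr (_ + _).
by rewrite mcoeffU eqmodE.
Qed.

(* A morphism M -> S killing N factors through M / N. *)
Lemma hom_factor (N M T S : module L) f g (u : 'M[k]_(mdim S, mdim M)) :
  @short_exact k L N M T f g -> is_hom u -> u *m f = 0 ->
  exists w, @is_hom k L T S w /\ u = w *m g.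
Proof.
move=> [hf hg injf surjg exfg] hu uf; have [h gh] := surjmx_section surjg.
have ue : u = u *m h *m g.
  apply: mulmx_ext => v; apply/eqP; rewrite -subr_eq0; apply/eqP.
  have [x xE] : exists x, v - h *m (g *m v) = f *m x.
    by apply: (exfg _).1; rewrite mulmxBr (mulmxA g h) gh mul1mx subrr.
  by rewrite -!mulmxA -mulmxBr xE mulmxA uf mul0mx.
exists (u *m h); split=> // a.
by rewrite -[T a]mulmx1 -gh [T a *m _]mulmxA -hg !mulmxA -ue hu.
Qed.

Lemma hom_count0 (S : simple_module L) M ss (u : 'M[k]_(mdim S, mdim M)) :
  comp_series M ss -> count (fun T : simple_module L => iso_rel T S) ss = 0 -> is_hom u -> u = 0.
Proof.
move=> c; elim: c u => {M ss} [M M0|N M T f g ss ex _ IH] u /=.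
  by move=> _ _; apply/matrixP => i j; have := ltn_ord j; rewrite [X in (_ < X)%N]M0.
move=> /eqP; rewrite addn_eq0 eqb0 => /andP [/asboolP nTS /eqP c0] hu.
have [hf hg _ _ _] := ex.
have [w [hw ->]] := hom_factor ex hu (IH _ c0 (is_homM hf hu)).
case: (schur (asboolW (smodP T)) (asboolW (smodP S)) hw) => [->|//].
by rewrite mul0mx.
Qed.

Hypothesis L_split : is_split L.

Lemma hom_count1 (S : simple_module L) M ss :
  comp_series M ss -> count (fun T : simple_module L => iso_rel T S) ss = 1 ->
  exists u0 : 'M[k]_(mdim S, mdim M), forall u, @is_hom k L M S u ->
    exists c, u = c *: u0.
Proof.
elim=> {M ss} [M M0|N M T f g ss ex cN IH] //=.
have [hf hg _ _ _] := ex.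
case: (boolP (iso_rel T S)) => [/asboolP [h [h' [hh h'h hh']]]|nTS] /=.
  move=> [c0]; exists (h *m g) => u hu.
  have [w [hw ->]] := hom_factor ex hu (hom_count0 cN c0 (is_homM hf hu)).
  have hh'' := is_hom_inv hh h'h hh'.
  have [c wE] := L_split (asboolW (smodP S)) (is_homM hh'' hw).
  exists c; rewrite -[w]mulmx1 -h'h mulmxA wE mul_scalar_mx.
  by rewrite -scalemxAl.
rewrite add0n => /IH [u0 u0E].
have zero (u : 'M[k]_(mdim S, mdim M)) : is_hom u -> u *m f = 0 -> u = 0.
  move=> hu uf; have [w [hw ->]] := hom_factor ex hu uf.
  case: (schur (asboolW (smodP T)) (asboolW (smodP S)) hw) => [->|i].
    by rewrite mul0mx.
  by case/asboolP: nTS.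
have [[u1 [hu1 u1f]]|no] := pselect (exists u1 : 'M[k]_(mdim S, mdim M),
    is_hom u1 /\ u1 *m f <> 0); last first.
  exists 0 => u hu; exists 0; rewrite scaler0; apply: zero => //.
  by apply: contrapT => uf; apply: no; exists u.
exists u1 => u hu; have [c1 c1E] := u0E _ (is_homM hf hu1).
have [c cE] := u0E _ (is_homM hf hu).
have c10 : c1 != 0 by apply/eqP => c10; apply: u1f; rewrite c1E c10 scale0r.
exists (c / c1); apply/eqP; rewrite -subr_eq0; apply/eqP; apply: zero.
  move=> a; rewrite mulmxBl mulmxBr hu -scalemxAl -scalemxAr hu1 //.
by rewrite mulmxBl -scalemxAl cE c1E scalerA divfK // subrr.
Qed.

Hypothesis L_basic : is_basic.

Lemma simple_dim (S : module L) : simple S -> mdim S = 1.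
Proof.
move=> sS; have [S0 _] := sS.
have [Q [p [[lp pM ps pk] Qm]]] := L_basic.
pose S' := SimpleModule (asboolT sS).
have := Qm S'; rewrite mcoeff_bar => /eqP; rewrite Num.Theory.pnatr_eq1 => /eqP cS.
have [u0 u0E] := hom_count1 (svalP (cid (comp_series_exists Q))) cS.
have [s sp] := boolp.choice ps.
pose u (v : 'cV[k]_(mdim S)) : 'M[k]_(mdim S, mdim Q) :=
  \matrix_(i, j) (S (s (delta_mx j 0)) *m v) i 0.
have uE v a : u v *m p a = S a *m v.
  have lS : linear (fun a => S a *m v : 'cV_(mdim S)).
    by move=> c x y; rewrite mact_linear mulmxDl -scalemxAl.
  have kS x : p x = 0 -> S x *m v = 0.
    by move=> /pk/(_ S sS) ->; rewrite mul0mx.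
  pose b := \sum_j p a j 0 *: s (delta_mx j 0).
  have pb : p b = p a.
    rewrite /b (linear_sumZ _ _ _ lp) [RHS]matrix_sum_delta.
    by apply: eq_bigr => j _; rewrite big_ord1 sp.
  have -> : S a *m v = S b *m v.
    apply/eqP; rewrite -subr_eq0; apply/eqP.
    rewrite -[_ - _]addrC -scaleN1r -[X in X + _]/(_ *: (fun a => S a *m v) b).
    rewrite -lS; apply: kS; by rewrite lp pb scaleN1r addNr.
  rewrite [RHS](linear_sumZ _ _ _ lS); apply/matrixP => i j.
  rewrite !mxE summxE; apply: eq_bigr => l _.
  by rewrite !mxE !ord1 mulrC.
have hu v : @is_hom k L Q S (u v).
  move=> a; apply: mulmx_ext => w; have [b <-] := ps w.
  by rewrite -!mulmxA uE -pM uE mactM mulmxA.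
have vE v : exists c, v = c *: (u0 *m p 1).
  have [c cE] := u0E _ (hu v); exists c.
  by rewrite scalemxAl -cE uE mact1 mul1mx.
apply/eqP; rewrite eqn_leq lt0n S0 andbT.
pose w : 'cV[k]_(mdim S) := u0 *m p 1.
have H : (fullv <= <[w]>)%VS.
  by apply/subvP => v _; apply/vlineP; have [c vc] := vE v; exists c; exact: vc.
move: (dimvS H); rewrite dimvf /dim /= muln1 dim_vline => le.
exact: leq_trans le (leq_b1 _).
Qed.

End Basic.

Section StructureGroup.
Context {k : fieldType} (L : hopfAlgType k).

Lemma tensm_simple : is_basic L -> is_split L ->
  forall S T : simple_module L, `[< simple (tensm S T) >].
Proof.
move=> Lb Ls S T; apply/asboolP/simple_dim1.
by rewrite /= !(simple_dim Ls Lb) //; apply: asboolW; apply: smodP.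
Qed.

Lemma dualm_simple : is_basic L -> is_split L ->
  forall S : simple_module L, `[< simple (dualm S) >].
Proof.
move=> Lb Ls S; apply/asboolP/simple_dim1.
by rewrite /= (simple_dim Ls Lb) //; apply: asboolW; apply: smodP.
Qed.

Lemma trivm_simple : `[< simple (trivm : module L) >].
Proof. by apply/asboolP/simple_dim1. Qed.

(* The hypotheses are not used by the carrier, only by the group structure. *)
Definition structure_group (Lb : is_basic L) (Ls : is_split L) : Type :=
  simple_class L.

Section Group.
Variables (Lb : is_basic L) (Ls : is_split L).
Local Notation G := (structure_group Lb Ls).

HB.instance Definition _ := Choice.on G.
HB.instance Definition _ := EqQuotient.on G.

Definition sg_one : G := sclass (SimpleModule trivm_simple).
Definition sg_mul (x y : G) : G :=
  sclass (SimpleModule (tensm_simple Lb Ls (repr x) (repr y))).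
Definition sg_inv (x : G) : G :=
  sclass (SimpleModule (dualm_simple Lb Ls (repr x))).

Lemma sg_ind (P : G -> Prop) : (forall S, P (sclass S)) -> forall x, P x.
Proof. by move=> h; elim/quotW. Qed.

Lemma repr_sclass (S : simple_module L) : iso (repr (sclass S : G)) S.
Proof. by apply/sclassP; rewrite /sclass reprK. Qed.

Lemma sg_mulE S T :
  sg_mul (sclass S) (sclass T) = sclass (SimpleModule (tensm_simple Lb Ls S T)).
Proof. by apply/eqP/sclassP/iso_tens; apply: repr_sclass. Qed.

Fact sg_mulA : associative sg_mul.
Proof.
elim/sg_ind=> S; elim/sg_ind=> T; elim/sg_ind=> U; rewrite !sg_mulE.
by apply/eqP/sclassP/iso_tensA.
Qed.

Fact sg_mul1 : left_id sg_one sg_mul.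
Proof.
elim/sg_ind=> S; rewrite sg_mulE; apply/eqP/sclassP/iso_sym; exact: iso_tens1m.
Qed.

Fact sg_mulr1 : right_id sg_one sg_mul.
Proof.
elim/sg_ind=> S; rewrite sg_mulE; apply/eqP/sclassP/iso_sym; exact: iso_tensm1.
Qed.

Fact repr_dim (x : G) : mdim (repr x) = 1.
Proof. exact: (simple_dim Ls Lb (asboolW (smodP _))). Qed.

Fact sg_mulV : left_inverse sg_one sg_inv sg_mul.
Proof.
move=> x; rewrite -{2}[x]reprK sg_mulE; apply/eqP/sclassP.
exact: (iso_dual1 (repr_dim x)).1.
Qed.

Fact sg_mulrV : right_inverse sg_one sg_inv sg_mul.
Proof.
move=> x; rewrite -{1}[x]reprK sg_mulE; apply/eqP/sclassP.
exact: (iso_dual1 (repr_dim x)).2.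
Qed.

HB.instance Definition _ := isGroup.Build G
  sg_mulA sg_mul1 sg_mulr1 sg_mulV sg_mulrV.

End Group.
End StructureGroup.

(* Main.v *)
Require Import Defs.
From HB Require Import structures.
From mathcomp Require Import all_boot all_order all_algebra all_field.
From mathcomp Require Import boolp.
From mathcomp.real_closed Require Import mxtens.
From mathcomp Require Import finmap.
From mathcomp.multinomials Require Import monalg.

(** Every simple module S is one-dimensional, so S (x) - and - (x) S amount to
    twisting modules by automorphisms of the algebra L ([tens1_twist],
    [tensr1_twist]).  Twisting is an autoequivalence, hence S (x) P1 and
    P1 (x) S are both projective covers of S, and they are isomorphic
    ([tens1C_cover]).  In K_0(L), let sigma be the ring morphism from the
    integral group ring of the structure group that sends the class of S to
    [S].  The class [P1] then commutes with the image of sigma, and sigma(S) [P1]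
    is the class of the projective cover of S.

    A composition series of P1 filters P1 (x) P1 by the projective modules
    S (x) P1, so the filtration splits and [P1]^2 = sigma(c) [P1]
    ([K0_class_filtration], [K0_cover_sqr]).  With the two relations above,
    (s, t) |-> sigma(s) + sigma(t) [P1] is multiplicative for the product of
    the theorem ([adjoinM]).  Its image is the projective class ring: a
    semisimple module is a sum of simple modules, and a projective module is a
    sum of projective covers of simple modules ([K0_class_semisimple],
    [K0_class_projective]).

    Injectivity needs, for each simple S, two linear forms on K_0(L) that
    separate [S] from the class of its cover.  For a subspace F(M) of M that is
    functorial in M, dim F(M) is additive on split exact sequences and defines
    such a form ([K0_dim]).  With J the annihilator of S, the subspaces M, J M
    and the space of vectors killed by J provide the number of copies of S in
    the top of M, and the number of direct summands of M isomorphic to S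
    ([exists_top_mult], [exists_summand_mult]).  On sigma(s) + sigma(t) [P1]
    these numbers are s_S + t_S and s_S, provided that no simple module is its
    own projective cover, that is, provided that L is not semisimple
    ([cover_dim1_semisimple]). *)

Set Implicit Arguments.
Unset Strict Implicit.
Unset Printing Implicit Defensive.

Import GRing.Theory.
Local Open Scope ring_scope.

(** * Extensions, projective covers and semisimple modules *)

Section Covers.
Context {k : fieldType} {L : falgType k}.
Implicit Types M N P Q S : module L.

HB.instance Definition _ M :=
  GRing.isLinear.Build k L _ _ (mact M) (@mact_linear _ _ M).

Definition lmx m n (f : 'M[k]_(m, n)) : 'Hom('cV[k]_n, 'cV[k]_m) :=
  linfun (mulmx f).

Lemma lmxE m n (f : 'M[k]_(m, n)) v : lmx f v = f *m v.
Proof. by rewrite lfunE. Qed.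

Lemma dim_cV n : \dim {:'cV[k]_n} = n.
Proof. by rewrite dimvf /dim /= muln1. Qed.

Lemma mem_img m n (f : 'M[k]_(m, n)) (U : {vspace 'cV[k]_n}) v :
  v \in U -> f *m v \in (lmx f @: U)%VS.
Proof. by move=> vU; rewrite -lmxE memv_img. Qed.

Lemma imgP m n (f : 'M[k]_(m, n)) (U : {vspace 'cV[k]_n}) w :
  w \in (lmx f @: U)%VS -> exists2 v, v \in U & w = f *m v.
Proof. by move=> /memv_imgP [v vU ->]; exists v; rewrite ?lmxE. Qed.

Lemma mem_lker m n (f : 'M[k]_(m, n)) v : (v \in lker (lmx f)) = (f *m v == 0).
Proof. by rewrite memv_ker lmxE. Qed.

Lemma mem_preim m n (f : 'M[k]_(m, n)) (U : {vspace 'cV[k]_m}) v :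
  (v \in (lmx f @^-1: U)%VS) = (f *m v \in U).
Proof. by rewrite -memv_preim lmxE. Qed.

Lemma fullvP n (U : {vspace 'cV[k]_n}) : (forall v, v \in U) -> U = fullv.
Proof. by move=> h; apply/eqP; rewrite eqEsubv subvf; apply/subvP => v _. Qed.

Lemma submodule_img M N (f : 'M[k]_(mdim N, mdim M)) U :
  is_hom f -> @submodule _ _ M U -> @submodule _ _ N (lmx f @: U)%VS.
Proof.
by move=> hf sU a _ /imgP [v vU ->]; rewrite mulmxA -hf -mulmxA mem_img ?sU.
Qed.

Lemma submodule_ker M N (f : 'M[k]_(mdim N, mdim M)) :
  is_hom f -> @submodule _ _ M (lker (lmx f)).
Proof.
move=> hf a v; rewrite !mem_lker => /eqP fv.
by rewrite mulmxA hf -mulmxA fv mulmx0.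
Qed.

Lemma submodule_full M : @submodule k L M fullv.
Proof. by move=> *; apply: memvf. Qed.

Lemma surjmxM m n p (f : 'M[k]_(m, n)) (g : 'M[k]_(p, m)) :
  surjmx f -> surjmx g -> surjmx (g *m f).
Proof.
by move=> sf sg w; have [v <-] := sg w; have [u <-] := sf v; exists u;
  rewrite mulmxA.
Qed.

Lemma surjmx_of_section m n (g : 'M[k]_(m, n)) h : g *m h = 1%:M -> surjmx g.
Proof. by move=> gh w; exists (h *m w); rewrite mulmxA gh mul1mx. Qed.

(** The projection 1 - s g takes its values in ker g = im f, hence factors
    through f. Both k-linear and L-linear sections are needed: linear ones
    always exist, and the retraction is a homomorphism as soon as s is one. *)
Lemma short_exact_retraction M1 M2 M3 (f : 'M[k]_(mdim M2, mdim M1))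
    (g : 'M[k]_(mdim M3, mdim M2)) s : short_exact f g -> g *m s = 1%:M ->
  exists r, [/\ r *m f = 1%:M, f *m r + s *m g = 1%:M
    & is_hom s -> @is_hom k L M2 M1 r].
Proof.
move=> [hf hg injf surjg exfg] gs.
have ker (v : 'cV_(mdim M2)) : exists u, (1%:M - s *m g) *m v = f *m u.
  apply: (exfg _).1; rewrite mulmxA mulmxBr mulmx1 mulmxA gs mul1mx subrr.
  by rewrite mul0mx.
have [c cE] := boolp.choice (fun j => ker (delta_mx j 0)).
pose r : 'M[k]_(mdim M1, mdim M2) := \matrix_(i, j) c j i 0.
have fr : f *m r = 1%:M - s *m g.
  apply/matrixP => i j; have /matrixP/(_ i 0) := cE j.
  by rewrite -colE mxE => ->; rewrite !mxE; apply: eq_bigr => l _; rewrite !mxE.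
have gf : g *m f = 0.
  by apply: mulmx_ext => v; rewrite mul0mx -mulmxA; apply: (exfg _).2; exists v.
have finj m (A B : 'M_(_, m)) : f *m A = f *m B -> A = B.
  move=> e; apply: mulmx_ext => v; apply/eqP; rewrite -subr_eq0 -mulmxBl.
  by apply/eqP/injf; rewrite mulmxA mulmxBr e subrr mul0mx.
exists r; split; last 1 first.
- move=> hs a; apply: finj; rewrite !mulmxA hf -[_ *m f *m r]mulmxA fr.
  by rewrite mulmxBl mulmxBr mul1mx mulmx1 -(mulmxA s) hg !mulmxA hs.
- apply: finj; rewrite mulmxA fr mulmxBl -mulmxA gf mulmx0 subr0.
  by rewrite mul1mx mulmx1.
by rewrite fr subrK.
Qed.

Lemma idempotents_mul0 m n p (f : 'M[k]_(n, m)) (g : 'M[k]_(p, n)) r s :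
  r *m f = 1%:M -> g *m s = 1%:M -> f *m r + s *m g = 1%:M -> g *m f = 0.
Proof.
move=> rf gs E; have : f *m (r *m f) + s *m (g *m f) = f.
  by rewrite !mulmxA -mulmxDl E mul1mx.
rewrite rf mulmx1 -[RHS]addr0 => /addrI sgf.
by rewrite -[g *m f]mul1mx -gs -mulmxA sgf mulmx0.
Qed.

(** The converse of the previous splitting. These identities, unlike exactness
    itself, are visibly preserved by tensoring with an identity matrix. *)
Lemma short_exact_of_lin M1 M2 M3 (f : 'M[k]_(mdim M2, mdim M1))
    (g : 'M[k]_(mdim M3, mdim M2)) r s : is_hom f -> is_hom g ->
  r *m f = 1%:M -> g *m s = 1%:M -> f *m r + s *m g = 1%:M -> short_exact f g.
Proof.
move=> hf hg rf gs E; have gf := idempotents_mul0 rf gs E.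
split=> //.
- by move=> v fv; rewrite -[v]mul1mx -rf -mulmxA fv mulmx0.
- exact: surjmx_of_section gs.
move=> v; split=> [gv|[u ->]]; last by rewrite mulmxA gf mul0mx.
by exists (r *m v); rewrite -[LHS]mul1mx -E mulmxDl -!mulmxA gv mulmx0 addr0.
Qed.

Lemma short_exact_ker M Q (h : 'M[k]_(mdim Q, mdim M)) :
  is_hom h -> surjmx h -> exists N f, @short_exact k L N M Q f h.
Proof.
move=> hh sh.
have [N [Q' [f [g [[hf _ fi _ fg] _ _ gU]]]]] :=
  submodule_exact (submodule_ker hh).
exists N, f; split=> // v; rewrite -fg.
have e : (h *m v == 0) = (g *m v == 0) by rewrite gU mem_lker.
by split=> /eqP hv; apply/eqP; rewrite ?e // -e.
Qed.

Lemma split_exact_section M1 M2 M3 (f : 'M[k]_(mdim M2, mdim M1))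
    (g : 'M[k]_(mdim M3, mdim M2)) s :
  short_exact f g -> is_hom s -> g *m s = 1%:M -> @split_exact _ _ M1 M2 M3.
Proof. by move=> ex hs gs; exists f, g; split=> //; exists s. Qed.

Lemma projective_section P M (g : 'M[k]_(mdim P, mdim M)) :
  projective P -> is_hom g -> surjmx g ->
  exists s, @is_hom k L P M s /\ g *m s = 1%:M.
Proof. by move=> pP hg sg; apply: (pP _ _ g) => //; apply: is_hom1. Qed.

Lemma projective_split_exact M1 M2 M3 f g :
  projective M3 -> @short_exact k L M1 M2 M3 f g -> split_exact M1 M2 M3.
Proof.
move=> pM ex; have [_ hg _ sg _] := ex.
have [s [hs gs]] := projective_section pM hg sg.
exact: split_exact_section ex hs gs.
Qed.

Lemma projective_retract P Q (i : 'M[k]_(mdim P, mdim Q)) r :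
  is_hom i -> is_hom r -> r *m i = 1%:M -> projective P -> projective Q.
Proof.
move=> hi hr ri pP M N g f hg sg hf.
have [h [hh gh]] := pP _ _ _ _ hg sg (is_homM hr hf).
exists (h *m i); split; first exact: is_homM hi hh.
by rewrite mulmxA gh -mulmxA ri mulmx1.
Qed.

Lemma projective_ext M1 M2 M3 f g : @short_exact k L M1 M2 M3 f g ->
  projective M1 -> projective M3 -> projective M2.
Proof.
move=> ex p1 p3.
have [hf hg _ sg _] := ex; have [s [hs gs]] := projective_section p3 hg sg.
have [r [_ E /(_ hs) hr]] := short_exact_retraction ex gs.
move=> M N q h hq sq hh.
have [h1 [hh1 e1]] := p1 _ _ _ _ hq sq (is_homM hf hh).
have [h3 [hh3 e3]] := p3 _ _ _ _ hq sq (is_homM hs hh).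
exists (h1 *m r + h3 *m g); split.
  move=> a; rewrite mulmxDl mulmxDr -!mulmxA hr hg !mulmxA.
  by rewrite hh1 hh3.
by rewrite mulmxDr !mulmxA e1 e3 -!mulmxA -mulmxDr E mulmx1.
Qed.

Lemma iso_projective P Q : iso P Q -> projective P -> projective Q.
Proof.
by move=> /iso_sym [f [g [hf gf fg]]]; apply: (projective_retract hf _ gf);
  apply: is_hom_inv gf fg.
Qed.

(** The condition on p in [projective_cover], isolated because it is also used
    for modules that are not projective, in particular for the identity of a
    simple module. *)
Definition essential M N (p : 'M[k]_(mdim N, mdim M)) :=
  [/\ is_hom p, surjmx p & forall U, @submodule _ _ M U ->
        (forall w : 'cV_(mdim N), exists2 u, u \in U & p *m u = w) ->
        U = fullv].

(** The image of h is a submodule that p maps onto M. *)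
Lemma essential_surj P M X p (h : 'M[k]_(mdim P, mdim X)) :
  @essential P M p -> is_hom h -> surjmx (p *m h) -> surjmx h.
Proof.
move=> [hp _ pU] hh sph w.
have e := pU _ (submodule_img hh (@submodule_full X)).
have /imgP [v _ ->] : w \in (lmx h @: fullv)%VS; last by exists v.
rewrite e ?memvf // => u; have [v <-] := sph u.
by exists (h *m v); rewrite ?mulmxA // mem_img ?memvf.
Qed.

(** Lift p through q to get h : P -> Q. It is onto because q is essential,
    hence has a section s; that section lifts q through p, so it is onto as
    well. *)
Lemma projective_cover_uniq P Q M :
  projective_cover P M -> projective_cover Q M -> iso P Q.
Proof.
move=> [pP [p ep]] [pQ [q eq]]; have [hp sp _] := ep; have [hq sq _] := eq.
have [h [hh qh]] := pP _ _ _ _ hq sq hp.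
have sh : surjmx h by apply: (essential_surj eq) => //; rewrite qh.
have [s [hs e]] := projective_section pQ hh sh.
have ss : surjmx s.
  by apply: (essential_surj ep) => //; rewrite -qh -mulmxA e mulmx1.
have [t st] := surjmx_section ss.
have th : t = h by rewrite -[t]mul1mx -e -mulmxA st mulmx1.
by exists h, s; rewrite -{2}th; split.
Qed.

Lemma iso_cover P Q M N : iso P Q -> iso M N ->
  projective_cover P M -> projective_cover Q N.
Proof.
move=> iPQ [f [g [hf gf fg]]] [pP [p [hp sp pU]]].
split; first exact: iso_projective iPQ pP.
have [g' [f' [hg' gf' fg']]] := iso_sym iPQ.
have hf' := is_hom_inv hg' gf' fg'; have hg := is_hom_inv hf gf fg.
exists (f *m p *m g'); split; first exact: is_homM hg' (is_homM hp hf).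
  apply: (surjmxM _ (surjmxM sp _)); first exact: surjmx_of_section fg'.
  exact: surjmx_of_section fg.
move=> U sU Us; have e : (lmx g' @: U)%VS = fullv.
  apply: pU; first exact: submodule_img.
  move=> w; have [u uU uE] := Us (f *m w); exists (g' *m u); first exact: mem_img.
  by rewrite -[RHS]mul1mx -gf -mulmxA -uE !mulmxA gf mul1mx.
apply: fullvP => v; have /imgP [u uU uE] : g' *m v \in (lmx g' @: U)%VS.
  by rewrite e memvf.
by rewrite -[v]mul1mx -gf' -mulmxA uE mulmxA gf' mul1mx.
Qed.

(** A submodule is complemented once its quotient is projective. *)
Lemma all_projective_semisimple :
  (forall M, projective M) -> semisimple_alg L.
Proof.
move=> pj M U sU; have [N [Q [f [g [ex _ _ gU]]]]] := submodule_exact sU.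
have [_ hg _ sg _] := ex; have [s [hs gs]] := projective_section (pj Q) hg sg.
exists (lmx s @: fullv)%VS; split; first exact/submodule_img/submodule_full.
  apply: fullvP => v; rewrite -[v](subrK (s *m (g *m v))).
  apply: memv_add; last by rewrite mem_img ?memvf.
  by rewrite -gU mulmxBr (mulmxA g s) gs mul1mx subrr.
apply/eqP; rewrite -subv0; apply/subvP => v; rewrite memv_cap -gU memv0.
by case/andP => /eqP gv /imgP [u _ ve]; move: gv; rewrite ve mulmxA gs mul1mx => ->;
  rewrite mulmx0.
Qed.

Lemma mx_dim0 m n (A B : 'M[k]_(m, n)) : n = 0 -> A = B.
Proof. by move=> n0; subst n; rewrite !thinmx0. Qed.

Lemma simples_projective :
  (forall S, simple S -> projective S) -> forall M, projective M.
Proof.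
move=> pS M; have [ss c] := comp_series_exists M.
elim: c => {M ss} [M M0 N P g f _ _ _|N M S f g ss ex _ IH]; last first.
  exact: projective_ext ex IH (pS _ (asboolW (smodP S))).
exists 0; split; first by move=> a; rewrite mul0mx mulmx0.
exact: mx_dim0.
Qed.

(** Modular law: if W complements f(U) in M, the preimage of W complements U. *)
Lemma semisimple_sub N M (f : 'M[k]_(mdim M, mdim N)) :
  is_hom f -> injmx f -> semisimple M -> semisimple N.
Proof.
move=> hf fi ssM U sU; have [W [sW UW UcW]] := ssM _ (submodule_img hf sU).
exists (lmx f @^-1: W)%VS; split.
- by move=> a v; rewrite !mem_preim mulmxA hf -mulmxA; apply: sW.
- apply: fullvP => v.
  have /memv_addP [_ /imgP [u uU ->] [w wW vE]] :
      f *m v \in (lmx f @: U + W)%VS by rewrite UW memvf.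
  rewrite -[v](subrK u) addrC memv_add // mem_preim mulmxBr vE.
  by rewrite [_ + w]addrC addrK.
apply/eqP; rewrite -subv0; apply/subvP => v.
rewrite memv_cap mem_preim memv0 => /andP [vU vW].
have : f *m v \in (lmx f @: U :&: W)%VS by rewrite memv_cap mem_img.
by rewrite UcW memv0 => /eqP /fi ->.
Qed.

(** A complement W of ker g is mapped isomorphically onto M3, which gives the
    section. *)
Lemma semisimple_split_exact M1 M2 M3 f g :
  semisimple M2 -> @short_exact k L M1 M2 M3 f g -> split_exact M1 M2 M3.
Proof.
move=> ss ex; have [hf hg _ sg _] := ex; have [s0 gs0] := surjmx_section sg.
have [W [sW UW UcW]] := ss _ (submodule_ker hg).
have sec w : exists v, v \in W /\ g *m v = w.
  have [v <-] := sg w; have /memv_addP [u] : v \in (lker (lmx g) + W)%VS.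
    by rewrite UW memvf.
  by rewrite mem_lker => /eqP gu [x xW ->]; exists x;
    rewrite mulmxDr gu add0r.
have [c cE] := boolp.choice (fun j => sec (delta_mx j 0)).
pose s : 'M[k]_(mdim M2, mdim M3) := \matrix_(i, j) c j i 0.
have sE j : s *m delta_mx j 0 = c j.
  by rewrite -colE; apply/matrixP => i i'; rewrite !mxE ord1.
have gs : g *m s = 1%:M.
  apply/matrixP => i j; have /matrixP/(_ i 0) := (cE j).2.
  by rewrite -sE mulmxA -colE !mxE eqxx andbT.
have sWm v : s *m v \in W.
  rewrite [v]matrix_sum_delta mulmx_sumr memv_suml // => j _.
  by rewrite big_ord1 -scalemxAr memvZ // sE; case: (cE j).
apply: (split_exact_section ex _ gs) => a; apply: mulmx_ext => v.
(* Both sides lie in W, and g, which is injective on W, agrees on them. *)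
apply/eqP; rewrite -subr_eq0 -memv0 -UcW memv_cap mem_lker.
rewrite -!mulmxA mulmxBr !mulmxA gs mul1mx hg -(mulmxA _ g) gs mulmx1 subrr eqxx.
by rewrite memvB // -!mulmxA ?sW.
Qed.

End Covers.
(** * Twisting modules by algebra automorphisms *)

Section Twist.
Context {k : fieldType} {L : falgType k}.
Variables f g : {lrmorphism L -> L}.
Hypotheses (gK : cancel g f) (fK : cancel f g).
Implicit Types (M N P : module L) (h : {lrmorphism L -> L}).

(** Restriction of scalars along an automorphism of the algebra leaves
    matrices of homomorphisms and submodules unchanged, so it is an
    autoequivalence. *)
Lemma twistm_linear h M : linear (fun a => M (h a)).
Proof. by move=> c x y; rewrite !linearP. Qed.

Lemma twistm1 h M : M (h 1) = 1%:M.
Proof. by rewrite rmorph1 mact1. Qed.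

Lemma twistmM h M a b : M (h (a * b)) = M (h a) *m M (h b).
Proof. by rewrite rmorphM mactM. Qed.

Definition twistm h M : module L :=
  Module (twistm_linear h M) (twistm1 h M) (twistmM h M).

(** A lifting problem against the twisted module is one against P for the
    modules twisted by the inverse automorphism. *)
Lemma projective_twist P : projective P -> projective (twistm f P).
Proof.
move=> pP M N q u hq sq hu.
have [||w [hw qw]] := pP (twistm g M) (twistm g N) q u _ sq _.
- by move=> a; apply: hq.
- by move=> a; have := hu (g a); rewrite /= gK.
by exists w; split=> // a; have := hw (f a); rewrite /= fK.
Qed.

Lemma cover_twist P M :
  projective_cover P M -> projective_cover (twistm f P) (twistm f M).
Proof.
move=> [pP [p [hp sp pU]]]; split; first exact: projective_twist.
exists p; split=> // [a|U sU Us]; first exact: hp.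
by apply: pU => // a v vU; have := sU (g a) v vU; rewrite /= gK.
Qed.

End Twist.

(** * Tensoring with one-dimensional modules *)

Section TensorOneDim.
Context {k : fieldType} {L : hopfAlgType k}.
Implicit Types M P S : module L.

Lemma linear_rmul (c : L) : linear (fun x => x * c).
Proof. by move=> a u v; rewrite mulrDl scalerAl. Qed.

Lemma linear_lmul (c : L) : linear (fun x => c * x).
Proof. by move=> a u v; rewrite mulrDr scalerAr. Qed.

Lemma lrmorphism_of (f : L -> L) : linear f -> f 1 = 1 ->
  (forall a b, f (a * b) = f a * f b) -> exists F : {lrmorphism L -> L}, F =1 f.
Proof.
move=> lf f1 fM.
pose mf := GRing.isMonoidMorphism.Build L L f (conj f1 fM).
pose af := GRing.isLinear.Build k L L _ f lf.
by exists (HB.pack f mf af : {lrmorphism L -> L}).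
Qed.

Definition is_char (chi : L -> k) :=
  [/\ scalar chi, chi 1 = 1 & forall a b, chi (a * b) = chi a * chi b].

(** The automorphism of L that carries M to S (x) M, for S one-dimensional
    with character chi. *)
Definition ltwist (chi : L -> k) (a : L) : L :=
  tlift (fun x y => chi x *: y) (comul a).

Definition rtwist (chi : L -> k) (a : L) : L :=
  tlift (fun x y => chi y *: x) (comul a).

Lemma ltwist_bilin chi : is_char chi -> bilin (fun x y : L => chi x *: y).
Proof.
move=> [lc _ _]; split=> [v|u] c x y; first by rewrite lc scalerDl -scalerA.
by rewrite scalerDr !scalerA mulrC.
Qed.

Lemma rtwist_bilin chi : is_char chi -> bilin (fun x y : L => chi y *: x).
Proof. by move=> /ltwist_bilin [h1 h2]; split. Qed.

Lemma ltwist_linear chi : linear (ltwist chi).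
Proof. exact: (linear_comp' (tlift_linear _) (@comul_is_linear _ _)). Qed.

Lemma rtwist_linear chi : linear (rtwist chi).
Proof. exact: (linear_comp' (tlift_linear _) (@comul_is_linear _ _)). Qed.

Lemma ltwist_lrmorphism chi : is_char chi ->
  exists F : {lrmorphism L -> L}, F =1 ltwist chi.
Proof.
move=> cc; have bc := ltwist_bilin cc; have [lc c1 cM] := cc.
apply: lrmorphism_of => [||a b]; first exact: ltwist_linear.
  by rewrite /ltwist comul1 tlift_pure // c1 scale1r.
rewrite /ltwist comul_mul // (comp_tlift _ _ (linear_rmul _)).
apply: eq_tlift => x y.
rewrite (comp_tlift _ _ (linear_lmul _)).
by apply: eq_tlift => z w; rewrite cM -scalerAl -scalerAr scalerA.
Qed.

Lemma rtwist_lrmorphism chi : is_char chi ->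
  exists F : {lrmorphism L -> L}, F =1 rtwist chi.
Proof.
move=> cc; have bc := rtwist_bilin cc; have [lc c1 cM] := cc.
apply: lrmorphism_of => [||a b]; first exact: rtwist_linear.
  by rewrite /rtwist comul1 tlift_pure // c1 scale1r.
rewrite /rtwist comul_mul // (comp_tlift _ _ (linear_rmul _)).
apply: eq_tlift => x y.
rewrite (comp_tlift _ _ (linear_lmul _)).
by apply: eq_tlift => z w; rewrite cM -scalerAl -scalerAr scalerA.
Qed.

(** The convolution product of the dual algebra of L. *)
Definition conv (chi psi : L -> k) (a : L) : k^o :=
  tlift (fun x y => chi x * psi y : k^o) (comul a).

(** By coassociativity, chi |-> ltwist chi reverses products for the
    convolution, whereas chi |-> rtwist chi preserves them. *)
Lemma ltwist_comp chi psi a : scalar chi -> scalar psi ->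
  ltwist chi (ltwist psi a) = ltwist (conv psi chi) a.
Proof.
move=> lc lp; rewrite {2}/ltwist (comp_tlift _ _ (@ltwist_linear chi)).
transitivity (tlift (fun x y => tlift (fun y1 y2 => (psi x * chi y1) *: y2) (comul y))
   (comul a)).
  apply: eq_tlift => x y; rewrite (linear_Z _ _ (@ltwist_linear chi)).
  rewrite /ltwist (comp_tlift _ _ (@linear_scale _ _ _)).
  by apply: eq_tlift => y1 y2; rewrite scalerA.
rewrite -(@comul_assoc _ _ _ (fun x y z => (psi x * chi y) *: z)).
- apply: eq_tlift => x z; rewrite /conv.
  rewrite (@comp_tlift _ _ _ k^o L (fun c : k^o => c *: z)) //.
  by move=> c u v; rewrite scalerDl -scalerA.
- by move=> y z c u v; rewrite lp mulrDl scalerDl scalerA mulrA.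
- by move=> y z c u v; rewrite lc mulrDr scalerDl scalerA mulrCA.
- by move=> y z c u v; rewrite scalerDr !scalerA mulrC.
Qed.

Lemma rtwist_comp chi psi a : scalar chi -> scalar psi ->
  rtwist chi (rtwist psi a) = rtwist (conv chi psi) a.
Proof.
move=> lc lp; rewrite {2}/rtwist (comp_tlift _ _ (@rtwist_linear chi)).
transitivity (tlift (fun x z => tlift (fun x1 x2 => (chi x2 * psi z) *: x1) (comul x))
   (comul a)).
  apply: eq_tlift => x y; rewrite (linear_Z _ _ (@rtwist_linear chi)).
  rewrite /rtwist (comp_tlift _ _ (@linear_scale _ _ _)).
  by apply: eq_tlift => y1 y2; rewrite scalerA mulrC.
rewrite (@comul_assoc _ _ _ (fun x y z => (chi y * psi z) *: x)).
- apply: eq_tlift => x y; rewrite /conv.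
  rewrite (@comp_tlift _ _ _ k^o L (fun c : k^o => c *: x)) //.
  by move=> c u v; rewrite scalerDl -scalerA.
- by move=> y z c u v; rewrite scalerDr !scalerA mulrC.
- by move=> y z c u v; rewrite lc mulrDl scalerDl scalerA mulrA.
- by move=> y z c u v; rewrite lp mulrDr scalerDl scalerA mulrCA.
Qed.

(** A character is a group-like element of the dual Hopf algebra; composition
    with the antipode gives its convolution inverse. *)
Lemma char_antipode chi : is_char chi -> scalar (chi \o antipode) /\
  ((forall a, conv (chi \o antipode) chi a = counit a) /\
   (forall a, conv chi (chi \o antipode) a = counit a)).
Proof.
move=> [lc c1 cM]; have lS : scalar (chi \o antipode).
  by move=> c x y; rewrite /= antipode_is_linear lc.
have ce a : chi (counit a *: 1) = counit a.
  by rewrite (@linear_Z _ _ k^o _ _ _ lc) c1 /GRing.scale /= mulr1.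
split=> //; split=> a; rewrite /conv -[RHS]ce.
  rewrite -antipodel (@comp_tlift _ _ _ _ k^o _ _ _ lc).
  by apply: eq_tlift => x y; rewrite cM.
rewrite -antipoder (@comp_tlift _ _ _ _ k^o _ _ _ lc).
by apply: eq_tlift => x y; rewrite cM.
Qed.
Lemma ltwistK chi : is_char chi ->
  cancel (ltwist chi) (ltwist (chi \o antipode)) /\
  cancel (ltwist (chi \o antipode)) (ltwist chi).
Proof.
move=> cc; have [lS [e1 e2]] := char_antipode cc; have [lc _ _] := cc.
split=> a; rewrite ltwist_comp //; rewrite -[RHS]counitl;
  by apply: eq_tlift => x y; rewrite ?e1 ?e2.
Qed.

Lemma rtwistK chi : is_char chi ->
  cancel (rtwist chi) (rtwist (chi \o antipode)) /\
  cancel (rtwist (chi \o antipode)) (rtwist chi).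
Proof.
move=> cc; have [lS [e1 e2]] := char_antipode cc; have [lc _ _] := cc.
split=> a; rewrite rtwist_comp //; rewrite -[RHS]counitr;
  by apply: eq_tlift => x y; rewrite ?e1 ?e2.
Qed.

Lemma is_char_antipode chi : is_char chi -> is_char (chi \o antipode).
Proof.
move=> cc; have [lS _] := char_antipode cc; have [_ c1 cM] := cc; split=> //=.
  by rewrite antipode1.
by move=> a b; rewrite antipodeM cM mulrC.
Qed.

Lemma char_of_dim1 S : mdim S = 1 -> exists2 chi : L -> k,
  is_char chi & forall a, S a = (chi a)%:M.
Proof.
case: S => m M M1 M2 M3 /= e; subst m; exists (fun a => M a 0 0); last first.
  by move=> a; rewrite [LHS]mx11_scalar.
split; first by move=> c u v; rewrite M1 !mxE.
  by rewrite M2 mxE.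
by move=> a b; rewrite M3 [M a]mx11_scalar [M b]mx11_scalar -scalar_mxM !mxE.
Qed.

(** Both dimensions are only propositionally equal to the expected ones,
    whence the cast along an arbitrary proof e'. *)
Lemma tens1_scalar m n (e : m = 1) (e' : n = (m * n)%N) c (A : 'M[k]_n) :
  (c%:M : 'M_m) *t A = castmx (e', e') (c *: A).
Proof.
subst m; rewrite tens_scalar_mx -[esym _ in LHS]/(esym (mul1n n)).
by congr castmx; congr pair; apply: eq_irrelevance.
Qed.

Lemma scalar_tens1 m n (e : m = 1) (e' : n = (n * m)%N) c (A : 'M[k]_n) :
  A *t (c%:M : 'M_m) = castmx (e', e') (c *: A).
Proof.
subst m; rewrite tens_mx_scalar.
by congr castmx; congr pair; apply: eq_irrelevance.
Qed.

Lemma tens1_twist S : mdim S = 1 -> exists f g : {lrmorphism L -> L},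
  [/\ cancel f g, cancel g f & forall M, iso (tensm S M) (twistm f M)].
Proof.
move=> S1; have [chi cc SE] := char_of_dim1 S1.
have [f fE] := ltwist_lrmorphism cc.
have [g gE] := ltwist_lrmorphism (is_char_antipode cc).
have [e1 e2] := ltwistK cc.
exists f, g; split=> [a|a|M]; rewrite ?fE ?gE ?fE ?gE //.
have e : mdim M = (mdim S * mdim M)%N by rewrite S1 mul1n.
apply: iso_sym; apply: (@iso_cast k L (twistm f M) (tensm S M) e) => a /=.
rewrite fE /ltwist (comp_tlift _ _ (@mact_linear _ _ M)).
rewrite (comp_tlift _ _ (@linear_castmx _ _ _ _ _ _)) /tensm_act.
apply: eq_tlift => x y; rewrite SE (tens1_scalar S1 e).
by rewrite (linear_Z _ _ (@mact_linear _ _ M)).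
Qed.

Lemma tensr1_twist S : mdim S = 1 -> exists f g : {lrmorphism L -> L},
  [/\ cancel f g, cancel g f & forall M, iso (tensm M S) (twistm f M)].
Proof.
move=> S1; have [chi cc SE] := char_of_dim1 S1.
have [f fE] := rtwist_lrmorphism cc.
have [g gE] := rtwist_lrmorphism (is_char_antipode cc).
have [e1 e2] := rtwistK cc.
exists f, g; split=> [a|a|M]; rewrite ?fE ?gE ?fE ?gE //.
have e : mdim M = (mdim M * mdim S)%N by rewrite S1 muln1.
apply: iso_sym; apply: (@iso_cast k L (twistm f M) (tensm M S) e) => a /=.
rewrite fE /rtwist (comp_tlift _ _ (@mact_linear _ _ M)).
rewrite (comp_tlift _ _ (@linear_castmx _ _ _ _ _ _)) /tensm_act.
apply: eq_tlift => x y; rewrite SE (scalar_tens1 S1 e).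
by rewrite (linear_Z _ _ (@mact_linear _ _ M)).
Qed.

(** S (x) - is twisting by an automorphism, so it carries the cover of the
    trivial module to the cover of S (x) k = S. The same holds for - (x) S. *)
Lemma cover_tens1 S P : mdim S = 1 -> projective_cover P trivm ->
  projective_cover (tensm S P) S.
Proof.
move=> /tens1_twist [f [g [fK gK i]]] /(cover_twist gK fK); apply: iso_cover.
  exact/iso_sym.
exact: iso_trans (iso_sym (i _)) (iso_sym (iso_tensm1 _)).
Qed.

Lemma cover_tensr1 S P : mdim S = 1 -> projective_cover P trivm ->
  projective_cover (tensm P S) S.
Proof.
move=> /tensr1_twist [f [g [fK gK i]]] /(cover_twist gK fK); apply: iso_cover.
  exact/iso_sym.
exact: iso_trans (iso_sym (i _)) (iso_sym (iso_tens1m _)).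
Qed.

(** This makes the class of P central over the group ring, although the
    structure group need not be abelian: both sides are projective covers of
    S. *)
Lemma tens1C_cover S P : mdim S = 1 -> projective_cover P trivm ->
  iso (tensm S P) (tensm P S).
Proof.
by move=> S1 cP; apply: projective_cover_uniq (cover_tens1 S1 cP) (cover_tensr1 S1 cP).
Qed.

End TensorOneDim.
(** * Linear forms on the Grothendieck ring *)

Section IntegralExtension.
Context {T : monoidType} {V : zmodType} (h : T -> V).
Implicit Types x y : monoid_ring T.

(** The additive extension of h to the free abelian group on T. *)
Definition zext x : V := \sum_(t <- msupp x) h t *~ mcoeff t x.

Lemma zextEw (d : {fset T}) x : (msupp x `<=` d)%fset ->
  zext x = \sum_(t <- d) h t *~ mcoeff t x.
Proof.
move=> le; rewrite [LHS](big_fset_incl _ le) => //= t _ /mcoeff_outdom ->.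
by rewrite mulr0z.
Qed.

Fact zextB : {morph zext : x y / x - y}.
Proof.
move=> x y; have ly : (msupp y `<=` msupp x `|` msupp y)%fset by apply: fsubsetUr.
rewrite (zextEw (fsubsetUl (msupp x) (msupp y))) (zextEw ly) (zextEw (msuppB_le _ _)).
by rewrite -sumrB; apply: eq_bigr => t _; rewrite raddfB mulrzBr.
Qed.

Lemma zextU t : zext << t >> = h t.
Proof. by rewrite (zextEw msuppU_le) big_seq_fset1 mcoeffUU. Qed.

End IntegralExtension.

HB.instance Definition _ (T : monoidType) (V : zmodType) (h : T -> V) :=
  GRing.isZmodMorphism.Build (monoid_ring T) V (zext h) (zextB h).

Section GrothendieckRing.
Context {k : fieldType} {L : hopfAlgType k}.
Implicit Types M N : module L.
Local Open Scope ring_scope.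

HB.instance Definition _ :=
  GRing.isZmodMorphism.Build (monoid_ring (iso_class L)) (K0 L) (@K0_of k L)
    (@K0_ofB k L).

Lemma K0_class_split (M1 M2 M3 : module L) : split_exact M1 M2 M3 ->
  K0_class M2 = K0_class M1 + K0_class M3.
Proof.
move=> ex; apply/eqP; rewrite -K0_ofD K0_ofP; apply: split_rel_in.
by exists M1, M2, M3.
Qed.

Lemma K0_class_iso M N : iso M N -> K0_class M = K0_class N.
Proof. by move=> /mclassP/eqP e; rewrite /K0_class e. Qed.

Lemma K0_class_tens M N : K0_class (tensm M N) = K0_class M * K0_class N.
Proof. by rewrite [RHS]K0_mulE monoid_ringU mulr1 mclassM. Qed.

(** The zero maps give a split exact sequence 0 -> M -> M -> M -> 0. *)
Lemma K0_class_zero M : mdim M = 0 -> K0_class M = 0.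
Proof.
move=> M0; have z m (A B : 'M[k]_(m, mdim M)) : A = B by apply: mx_dim0.
have z' (v w : 'cV[k]_(mdim M)) : v = w by apply: trmx_inj; apply: z.
have h0 : @is_hom k L M M 0 by move=> a; apply: z.
have ex : @short_exact k L M M M 0 0.
  split; [exact: h0|exact: h0|by move=> v _; apply: z'| |].
    by move=> w; exists 0; apply: z'.
  by move=> v; split=> _; [exists 0|]; apply: z'.
have /K0_class_split : split_exact M M M by apply: (split_exact_section ex h0).
by rewrite -[LHS]addr0 => /addrI.
Qed.

(** The universal property of the Grothendieck group of split exact sequences. *)
Lemma K0_functional (d : module L -> int) :
  (forall M N, iso M N -> d M = d N) ->
  (forall M1 M2 M3, split_exact M1 M2 M3 -> d M2 = d M1 + d M3) ->
  exists D : {additive K0 L -> int}, forall M, D (K0_class M) = d M.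
Proof.
move=> di ds; pose e : {additive monoid_ring (iso_class L) -> int} :=
  zext (fun c : iso_class L => d (repr c)).
have eE M : e << mclass M >> = d M.
  by rewrite /e /= zextU; apply/di/mclassP; rewrite /mclass reprK.
have e0 x : x \in @split_relations k L -> e x = 0.
  move: x; apply: split_relations_ind => [x [M1 [M2 [M3 [ex ->]]]]||x y hx hy].
  - by rewrite !raddfB raddfD !eE (ds _ _ _ ex) subrr.
  - exact: raddf0.
  by rewrite raddfB hx hy subrr.
pose D (x : K0 L) : int := e (repr x).
have DE x : D (K0_of x) = e x.
  apply/eqP; rewrite -subr_eq0 -raddfB; apply/eqP/e0.
  by rewrite -K0_ofP /K0_of reprK.
have DB : {morph D : x y / x - y}.
  by elim/(@K0_ofW k L)=> x; elim/(@K0_ofW k L)=> y; rewrite -K0_ofB !DE raddfB.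
pose mD := GRing.isZmodMorphism.Build (K0 L) int D DB.
by exists (HB.pack D mD : {additive K0 L -> int}) => M /=; rewrite DE eE.
Qed.

(** A subfunctor of the forgetful functor to vector spaces. Its dimension is
    additive on split exact sequences, which is how linear forms on [K0] are
    produced below, without the Krull-Schmidt theorem. *)
Definition functorial (F : forall M : module L, {vspace 'cV[k]_(mdim M)}) :=
  forall M N f, @is_hom k L M N f -> forall v, v \in F M -> f *m v \in F N.

Lemma functorial_cap F G : functorial F -> functorial G ->
  functorial (fun M => F M :&: G M)%VS.
Proof.
move=> hF hG M N f hf v; rewrite !memv_cap => /andP [vF vG].
by rewrite (hF _ _ _ hf) ?(hG _ _ _ hf).
Qed.

Lemma functorial_full : functorial (fun M => fullv).
Proof. by move=> *; apply: memvf. Qed.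

Lemma dim_img_inj m n (f : 'M[k]_(m, n)) r (U : {vspace 'cV[k]_n}) :
  r *m f = 1%:M -> \dim (lmx f @: U) = \dim U.
Proof.
move=> rf; apply: limg_dim_eq; apply/eqP; rewrite -subv0; apply/subvP => v.
rewrite memv_cap mem_lker memv0 => /andP [_ /eqP fv].
by rewrite -[v]mul1mx -rf -mulmxA fv mulmx0.
Qed.

Lemma dim_functorial_iso F M N : functorial F -> iso M N ->
  \dim (F M) = \dim (F N).
Proof.
move=> hF; suff H M' N' : iso M' N' -> (\dim (F M') <= \dim (F N'))%N.
  by move=> i; apply/eqP; rewrite eqn_leq !H //; apply: iso_sym.
move=> [f [g [hf gf _]]]; rewrite -(dim_img_inj (F M') gf); apply: dimvS.
by apply/subvP => _ /imgP [v vF ->]; apply: (hF _ _ _ hf).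
Qed.

Lemma dim_functorial_split F M1 M2 M3 : functorial F -> split_exact M1 M2 M3 ->
  \dim (F M2) = (\dim (F M1) + \dim (F M3))%N.
Proof.
move=> hF /split_exactP [f [g [r [s [hf hg hr hs [rf gs E]]]]]].
rewrite -(dim_img_inj (F M1) rf) -(dim_img_inj (F M3) gs).
rewrite -dimv_disjoint_sum; last first.
  apply/eqP; rewrite -subv0; apply/subvP => v; rewrite memv_cap memv0.
  case/andP=> /imgP [u _ ->] /imgP [w _ e].
  have w0 : w = 0.
    rewrite -[w]mul1mx -gs -mulmxA -e mulmxA (idempotents_mul0 rf gs E).
    by rewrite mul0mx.
  by rewrite e w0 mulmx0.
congr (\dim _); apply/eqP; rewrite eqEsubv; apply/andP; split; apply/subvP => v.
  move=> vF; rewrite -[v]mul1mx -E mulmxDl -!mulmxA.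
  by rewrite memv_add // mem_img // ?(hF _ _ _ hr) ?(hF _ _ _ hg).
by case/memv_addP=> _ /imgP [u uF ->] [_ /imgP [w wF ->] ->];
  rewrite memvD ?(hF _ _ _ hf) ?(hF _ _ _ hs).
Qed.

Lemma K0_dim F : functorial F -> exists D : {additive K0 L -> int},
  forall M, D (K0_class M) = (\dim (F M))%:Z.
Proof.
move=> hF; apply: K0_functional => [M N i|M1 M2 M3 ex].
  by rewrite (dim_functorial_iso hF i).
by rewrite (dim_functorial_split hF ex) PoszD.
Qed.

Implicit Types J : {vspace L}.

(** The vectors killed by J, and below the subspace J M. Both are computed on
    a basis of J to stay within finite intersections and sums. *)
Definition killed J M : {vspace 'cV[k]_(mdim M)} :=
  (\bigcap_(i < \dim J) lker (lmx (M (vbasis J)`_i)))%VS.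

Definition ideal_img J M : {vspace 'cV[k]_(mdim M)} :=
  (\sum_(i < \dim J) limg (lmx (M (vbasis J)`_i)))%VS.

Lemma killedP J M v :
  reflect (forall a, a \in J -> M a *m v = 0) (v \in killed J M).
Proof.
apply: (iffP idP) => [|vJ]; rewrite memvE.
  move=> /subv_bigcapP vJ a /coord_vbasis ->.
  rewrite linear_sum mulmx_suml big1 // => i _; rewrite linearZ -scalemxAl.
  by have := vJ i isT; rewrite -memvE mem_lker => /eqP ->; rewrite scaler0.
apply/subv_bigcapP => i _; rewrite -memvE mem_lker vJ //.
by rewrite vbasis_mem ?mem_nth ?size_tuple.
Qed.

Lemma mem_ideal_img J M a v : a \in J -> M a *m v \in ideal_img J M.
Proof.
move=> /coord_vbasis ->; rewrite linear_sum mulmx_suml memv_suml // => i _.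
rewrite linearZ -scalemxAl memvZ //; apply: (subvP (sumv_sup i _ (subvv _))) => //.
by rewrite mem_img ?memvf.
Qed.

Lemma ideal_img_min J M (W : {vspace 'cV[k]_(mdim M)}) :
  (forall a v, a \in J -> M a *m v \in W) -> (ideal_img J M <= W)%VS.
Proof.
move=> h; apply/subv_sumP => i _; apply/subvP => _ /imgP [v _ ->]; apply: h.
by rewrite vbasis_mem ?mem_nth ?size_tuple.
Qed.

Lemma killed_functorial J : functorial (killed J).
Proof.
move=> M N f hf v /killedP vJ; apply/killedP => a aJ.
by rewrite mulmxA -hf -mulmxA vJ ?mulmx0.
Qed.

Lemma ideal_img_functorial J : functorial (ideal_img J).
Proof.
move=> M N f hf v vI; rewrite -mem_preim; apply: (subvP _ v vI).
apply: ideal_img_min => a u aJ; rewrite mem_preim mulmxA hf -mulmxA.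
exact: mem_ideal_img.
Qed.

End GrothendieckRing.
(** * Modules with a one-dimensional top *)

Section OneDimTop.
Context {k : fieldType} {L : hopfAlgType k}.
Implicit Types M N S T X : module L.

Definition annihilator S : {vspace L} := lker (linfun S).

Lemma mem_annihilator S a : (a \in annihilator S) = (S a == 0).
Proof. by rewrite memv_ker lfunE. Qed.

Lemma submodule_ideal_img S M :
  @submodule k L M (ideal_img (annihilator S) M).
Proof.
move=> b v; rewrite -mem_preim; apply/subvP: v; apply: ideal_img_min => a v aS.
rewrite mem_preim mulmxA -mactM mem_ideal_img //.
by rewrite mem_annihilator mactM (eqP (_ : S a == 0)) ?mulmx0 // -mem_annihilator.
Qed.

Lemma castmx_scalar m n (e : m = n) (c : k) :
  castmx (e, e) (c%:M : 'M_m) = c%:M :> 'M_n.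
Proof. by subst n; rewrite castmx_id. Qed.

Lemma dim1_line n (w w' : 'cV[k]_n) : n = 1 -> w != 0 -> exists c, w' = c *: w.
Proof.
move=> n1 w0; subst n; exists (w' 0 0 / w 0 0).
have w00 : w 0 0 != 0.
  by apply: contraNneq w0 => w00; apply/eqP/matrixP => i j; rewrite !ord1 mxE.
by apply/matrixP => i j; rewrite !ord1 mxE divfK.
Qed.

(** Otherwise S a = 0 would force T a = 0; applied to a - chi(a), with chi the
    character of S, this says that both characters are equal. *)
Lemma annihilator_separates S T : mdim S = 1 -> mdim T = 1 -> ~ iso S T ->
  exists2 a, a \in annihilator S & exists2 c, c != 0 & T a = c%:M.
Proof.
move=> S1 T1 nST; have [chi _ SE] := char_of_dim1 S1.
have [psi _ TE] := char_of_dim1 T1.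
have [e|/existsNP [a /eqP ne]] := pselect (forall a, chi a = psi a).
  case: nST; apply: (@iso_cast k L S T (etrans S1 (esym T1))) => a.
  by rewrite SE TE castmx_scalar e.
exists (a - (chi a)%:A).
  by rewrite mem_annihilator linearB linearZ /= mact1 SE scalemx1 subrr.
exists (psi a - chi a); first by rewrite subr_eq0 eq_sym.
by rewrite linearB linearZ /= mact1 TE scalemx1 -raddfB.
Qed.

Lemma annihilator_act S : mdim S = 1 -> exists chi : L -> k,
  forall a, a - (chi a)%:A \in annihilator S.
Proof.
move=> S1; have [chi _ SE] := char_of_dim1 S1; exists chi => a.
by rewrite mem_annihilator linearB linearZ /= mact1 SE scalemx1 subrr.
Qed.

Lemma iso_annihilator S T a : iso S T -> a \in annihilator S -> T a = 0.
Proof.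
move=> [f [g [hf gf fg]]]; rewrite mem_annihilator => /eqP Sa.
by rewrite -[T a]mulmx1 -fg mulmxA -hf Sa mulmx0 mul0mx.
Qed.

(** Let J be the annihilator of S. Some a in J acts invertibly on T, so p maps
    the submodule J X onto T, and p is essential. *)
Lemma ideal_img_top_neq S T X p : mdim S = 1 -> mdim T = 1 -> ~ iso S T ->
  @essential k L X T p -> ideal_img (annihilator S) X = fullv.
Proof.
move=> S1 T1 nST [hp sp]; apply; first exact: submodule_ideal_img.
have [a aS [c c0 Ta]] := annihilator_separates S1 T1 nST.
move=> w; have [v pv] := sp (c^-1 *: w); exists (X a *m v).
  exact: mem_ideal_img.
by rewrite mulmxA hp -mulmxA pv Ta mul_scalar_mx scalerA divff // scale1r.
Qed.

Lemma surj_dim1_neq0 m n (p : 'M[k]_(m, n)) : m = 1 -> surjmx p ->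
  exists v : 'cV_n, p *m v != 0.
Proof.
move=> m1 sp; have [v pv] := sp (const_mx 1); exists v; rewrite pv; subst m.
by apply/eqP => /matrixP/(_ 0 0)/eqP; rewrite !mxE oner_eq0.
Qed.

(** The kernel of p is the largest proper submodule of X. *)
Lemma essential_dim1 T X p (U : {vspace 'cV[k]_(mdim X)}) u : mdim T = 1 ->
  @essential k L X T p -> submodule U -> u \in U -> p *m u != 0 -> U = fullv.
Proof.
move=> T1 [_ _ pU] sU uU pu; apply: pU => // w.
have [c ->] := dim1_line w T1 pu.
by exists (c *: u); rewrite ?memvZ // scalemxAr.
Qed.

(** J kills S = T, so J X is contained in ker p. Conversely L acts on X / J X
    by scalars, so every subspace H that contains J X is a submodule, and lies
    in ker p when it is proper. If v in ker p were not in J X, a hyperplane H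
    containing J X but not v would exist, and then X = H + k v would be
    contained in ker p. *)
Lemma ideal_img_top_eq S T X p : mdim S = 1 -> mdim T = 1 -> iso S T ->
  @essential k L X T p -> ideal_img (annihilator S) X = lker (lmx p).
Proof.
move=> S1 T1 iST ep; have [hp sp _] := ep; set I := ideal_img _ X.
have [chi chiS] := annihilator_act S1.
apply/eqP; rewrite eqEsubv; apply/andP; split.
  apply: ideal_img_min => a v aS.
  by rewrite mem_lker mulmxA hp (iso_annihilator iST aS) !mul0mx.
apply/subvP => v; rewrite mem_lker => /eqP pv; apply: contrapT => vI.
pose W := ((I + <[v]>)^C)%VS.
have full : (I + <[v]> + W)%VS = fullv by apply: addv_complf.
have disj : ((I + <[v]>) :&: W)%VS = 0%VS by apply: capv_compl.
have sH : @submodule k L X (I + W)%VS.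
  move=> a h hH; have -> : X a *m h = X (a - (chi a)%:A) *m h + chi a *: h.
    rewrite linearB linearZ /= mact1 scalemx1 mulmxBl mul_scalar_mx.
    by rewrite subrK.
  rewrite memvD ?memvZ //; apply: (subvP (addvSl I W)).
  exact: mem_ideal_img.
have [u pu] := surj_dim1_neq0 T1 sp.
have pH : (I + W <= lker (lmx p))%VS.
  apply/subvP => h hH; rewrite mem_lker; apply: contraPT isT => ph _.
  have : v \in (I + W)%VS by rewrite (essential_dim1 T1 ep sH hH ph) memvf.
  move=> /memv_addP [i iI [w wW vE]]; apply: vI.
  suff w0 : w = 0 by rewrite vE w0 addr0.
  apply/eqP; rewrite -memv0 -disj memv_cap wW andbT.
  have -> : w = - i + v by rewrite vE addKr.
  by rewrite memv_add ?memvN ?memv_line.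
move: (memvf u); rewrite -full -addvA [(<[v]> + W)%VS]addvC addvA.
case/memv_addP=> h /(subvP pH); rewrite mem_lker => /eqP ph [_ /vlineP [c ->] uE].
by move: pu; rewrite uE mulmxDr ph -scalemxAr pv scaler0 addr0 eqxx.
Qed.

Lemma dim_ideal_img_top S T X p : mdim S = 1 -> mdim T = 1 ->
  @essential k L X T p ->
  mdim X = (iso_rel S T + \dim (ideal_img (annihilator S) X))%N.
Proof.
move=> S1 T1 ep; have [hp sp _] := ep; rewrite /iso_rel.
case: asboolP => [iST|nST]; last first.
  by rewrite (ideal_img_top_neq S1 T1 nST ep) dim_cV.
rewrite (ideal_img_top_eq S1 T1 iST ep).
transitivity (\dim {:'cV[k]_(mdim X)}); first by rewrite dim_cV.
rewrite -(limg_ker_dim (lmx p) fullv) capfv addnC; congr (_ + _)%N.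
rewrite (_ : limg (lmx p) = fullv) ?dim_cV //.
by apply: fullvP => w; have [v <-] := sp w; rewrite mem_img ?memvf.
Qed.

Lemma essential_id T : @essential k L T T 1%:M.
Proof.
split=> [||U _ h]; first exact: is_hom1.
  by move=> w; exists w; rewrite mul1mx.
by apply: fullvP => v; have [u uU] := h v; rewrite mul1mx => <-.
Qed.

(** If S is not T then J X = X. If S = T, a vector v killed by J spans a
    submodule; when v is not in J X = ker p, this submodule is all of X, which
    then has dimension 1. *)
Lemma killed_top S T X p : mdim S = 1 -> mdim T = 1 -> @essential k L X T p ->
  mdim X != 1 -> (killed (annihilator S) X <= ideal_img (annihilator S) X)%VS.
Proof.
move=> S1 T1 ep X1; have [hp sp _] := ep.
have [iST|nST] := pselect (iso S T); last first.
  by rewrite (ideal_img_top_neq S1 T1 nST ep) subvf.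
rewrite (ideal_img_top_eq S1 T1 iST ep); apply/subvP => v /killedP vS.
rewrite mem_lker; apply: contraNT X1 => pv.
have [chi chiS] := annihilator_act S1.
have sv : @submodule k L X <[v]>%VS.
  move=> a _ /vlineP [c ->]; rewrite -scalemxAr memvZ //; apply/vlineP.
  exists (chi a); apply/eqP; rewrite -subr_eq0 -mul_scalar_mx -mulmxBl -scalemx1.
  by rewrite -mact1 -linearZ -linearB /= vS.
have v0 : v != 0 by apply: contraNneq pv => ->; rewrite mulmx0.
have := dim_vline v; rewrite (essential_dim1 T1 ep sv (memv_line v) pv) dim_cV.
by rewrite v0 => ->.
Qed.

(** A(M) = dim M - dim J M = dim M / J M counts the copies of S in the top of
    M. It takes the same value on a one-dimensional module and on its
    projective cover. *)
Lemma exists_top_mult S : mdim S = 1 ->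
  exists A : {additive K0 L -> int}, forall T X p, mdim T = 1 ->
    @essential k L X T p -> A (K0_class X) = (iso_rel S T)%:R.
Proof.
move=> S1; have [D DE] := K0_dim (@functorial_full k L).
have [D' DE'] := K0_dim (@ideal_img_functorial k L (annihilator S)).
exists (D \- D') => T X p T1 ep /=; rewrite DE DE' dim_cV.
by rewrite [X in Posz X](dim_ideal_img_top S1 T1 ep) PoszD addrK natz.
Qed.

(** B(M) is the dimension of the subspace killed by J modulo its intersection
    with J M: it counts the direct summands of M isomorphic to S. Unlike the
    top multiplicity, it tells a one-dimensional module from a larger
    projective cover. *)
Lemma exists_summand_mult S : mdim S = 1 ->
  exists B : {additive K0 L -> int},
    (forall T, mdim T = 1 -> B (K0_class T) = (iso_rel S T)%:R) /\
    (forall T X p, mdim T = 1 -> @essential k L X T p -> mdim X != 1 ->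
      B (K0_class X) = 0).
Proof.
move=> S1; pose J := annihilator S.
have hK := @killed_functorial k L J.
have [D DE] := K0_dim hK.
have [D' DE'] := K0_dim (functorial_cap hK (@ideal_img_functorial k L J)).
exists (D \- D'); split=> [T T1|T X p T1 ep X1] /=; rewrite DE DE'; last first.
  by rewrite (capv_idPl (killed_top S1 T1 ep X1)) subrr.
have e := dim_ideal_img_top S1 T1 (@essential_id T).
rewrite /iso_rel in e *; case: asboolP e => [iST|nST] /=.
  move=> e; have := etrans (esym T1) e => /eqP; rewrite add1n eqSS eq_sym dimv_eq0 => /eqP ->.
  rewrite capv0 dimv0 subr0 (_ : killed J T = fullv) ?dim_cV ?T1 //.
  by apply: fullvP => v; apply/killedP => a /(iso_annihilator iST) ->; rewrite mul0mx.
by rewrite (ideal_img_top_neq S1 T1 nST (@essential_id T)) capvf subrr.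
Qed.

End OneDimTop.
(** * Rings over an integral monoid ring *)

Section ZextRing.
Context {G : monoidType} {R : pzRingType} (h : G -> R).
Implicit Types x y : monoid_ring G.

Lemma zext1 : h 1%g = 1 -> zext h 1 = 1.
Proof. by move=> h1; rewrite zextU. Qed.

Lemma zextM : (forall u v, h (u * v)%g = h u * h v) ->
  {morph zext h : x y / x * y}.
Proof.
move=> hM; apply: monoid_ring_ind => [y|x x' hx hx' y|u].
- by rewrite mul0r raddf0 mul0r.
- by rewrite mulrBl !raddfB /= hx hx' mulrBl.
apply: monoid_ring_ind => [|x x' hx hx'|v].
- by rewrite mulr0 raddf0 mulr0.
- by rewrite mulrBr !raddfB /= hx hx' mulrBr.
by rewrite monoid_ringU mulr1 !zextU hM.
Qed.

Lemma zext_comm (p : R) : (forall u, p * h u = h u * p) ->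
  forall x, p * zext h x = zext h x * p.
Proof.
move=> pC; apply: monoid_ring_ind => [|x x' hx hx'|u].
- by rewrite raddf0 mul0r mulr0.
- by rewrite raddfB mulrBl mulrBr hx hx'.
by rewrite zextU.
Qed.

(** Reduces the values of linear forms on products to the values on basis
    elements. *)
Lemma additive_zext (f : {additive R -> int}) (p : R) x :
  f (zext h x * p) = zext (fun u => f (h u * p)) x.
Proof.
move: x; apply: monoid_ring_ind => [|x x' hx hx'|u].
- by rewrite !raddf0 mul0r raddf0.
- by rewrite raddfB mulrBl !raddfB /= hx hx'.
by rewrite !zextU.
Qed.

End ZextRing.

Lemma zext_delta (G : monoidType) (u : G) (x : monoid_ring G) :
  zext (fun v => (v == u)%:R) x = mcoeff u x.
Proof.
move: x; apply: monoid_ring_ind => [|x x' hx hx'|v].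
- by rewrite raddf0 mcoeff0.
- by rewrite raddfB /= hx hx' mcoeffB.
by rewrite zextU [RHS]mcoeffU.
Qed.

Section QuadraticExtension.
Context {A R : pzRingType} (sigma : {rmorphism A -> R}) (c : A) (p : R).
Hypotheses (pC : forall s, p * sigma s = sigma s * p).
Hypothesis (pp : p * p = sigma c * p).

(** The pair (s, t) stands for s + t x in A[x] modulo x^2 = c x, where x
    commutes with A; this is the source of the product in the theorem. *)
Definition adjoin (x : A * A) : R := sigma x.1 + sigma x.2 * p.

Lemma adjoinD : {morph adjoin : x y / x + y}.
Proof. by move=> x y; rewrite /adjoin !raddfD /= mulrDl addrACA. Qed.

Lemma adjoinB : {morph adjoin : x y / x - y}.
Proof. by move=> x y; rewrite /adjoin !raddfB /= mulrBl opprD addrACA. Qed.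

Lemma adjoin1 : adjoin (1, 0) = 1.
Proof. by rewrite /adjoin rmorph1 rmorph0 mul0r addr0. Qed.

Lemma adjoinM s1 t1 s2 t2 : adjoin (s1, t1) * adjoin (s2, t2) =
  adjoin (s1 * s2, s1 * t2 + t1 * s2 + t1 * c * t2).
Proof.
rewrite /adjoin /= !rmorphD !rmorphM mulrDl !mulrDr !mulrDl -!addrA.
congr (_ + _); congr (_ + _); first by rewrite mulrA.
congr (_ + _); first by rewrite -mulrA pC mulrA.
by rewrite -(pC t2) mulrA -(mulrA _ p p) pp mulrA -(mulrA _ p) pC mulrA.
Qed.

End QuadraticExtension.
(** * Classes of filtered, semisimple and projective modules *)

Section ClassFormulas.
Context {k : fieldType} {L : hopfAlgType k}.
Implicit Types M N P : module L.

Lemma short_exact_tensr N M1 M2 M3 f g : @short_exact k L M1 M2 M3 f g ->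
  exists f' g', @short_exact k L (tensm M1 N) (tensm M2 N) (tensm M3 N) f' g'.
Proof.
move=> ex; have [hf hg _ sg _] := ex; have [s gs] := surjmx_section sg.
have [r [rf E _]] := short_exact_retraction ex gs; have h1 := @is_hom1 _ _ N.
exists (f *t 1%:M), (g *t 1%:M).
apply: (@short_exact_of_lin _ _ (tensm M1 N) (tensm M2 N) (tensm M3 N) _ _
  (r *t 1%:M) (s *t 1%:M)); rewrite ?tensmx_mul ?rf ?gs ?mulmx1 ?tensmx11 //;
  try exact: is_hom_tens.
by rewrite -[X in X + _]scale1r -tensmxDl scale1r E tensmx11.
Qed.

(** A composition series of M induces a filtration of M (x) P whose factors S
    (x) P are projective, so that all its steps split. *)
Lemma K0_class_filtration P M ss :
  (forall S : simple_module L, projective (tensm S P)) -> comp_series M ss ->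
  K0_class M * K0_class P = \sum_(S <- ss) K0_class S * K0_class P.
Proof.
move=> pSP; elim=> {M ss} [M M0|N M S f g ss ex _ IH].
  by rewrite big_nil K0_class_zero // mul0r.
have [f' [g' ex']] := short_exact_tensr P ex.
have /K0_class_split := projective_split_exact (pSP S) ex'.
by rewrite !K0_class_tens IH big_cons addrC.
Qed.

Lemma K0_class_semisimple M ss : semisimple M -> comp_series M ss ->
  K0_class M = \sum_(S <- ss) K0_class S.
Proof.
move=> ssM c; elim: c ssM => {M ss} [M M0|N M S f g ss ex _ IH] ssM.
  by rewrite big_nil K0_class_zero.
have [hf _ fi _ _] := ex.
rewrite (K0_class_split (semisimple_split_exact ssM ex)) big_cons addrC IH //.
exact: semisimple_sub hf fi ssM.
Qed.

Lemma simple_semisimple (S : module L) : simple S -> semisimple S.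
Proof.
move=> [_ sS] U sU; case: (sS U sU) => ->.
  exists fullv; split; [exact: submodule_full|exact: add0v|exact: cap0v].
exists 0%VS; split; [|exact: addv0|exact: capv0].
by move=> a v; rewrite !memv0 => /eqP ->; rewrite mulmx0.
Qed.

(** A nonzero projective module P maps onto a simple module S. The lift of
    this map to the cover Q S is onto, hence splits, and its kernel is
    projective of smaller dimension. *)
Lemma K0_class_projective (Q : simple_module L -> module L) :
  (forall S : simple_module L, projective_cover (Q S) S) ->
  forall P, projective P ->
  exists ss : seq (simple_module L), K0_class P = \sum_(S <- ss) K0_class (Q S).
Proof.
move=> cQ P; have [n] := ubnP (mdim P); elim: n P => // n IHn P; rewrite ltnS.
move=> Pn pP; have [ss0 c] := comp_series_exists P.
case: P ss0 / c Pn pP => [M M0 _ _|N M S f g ss ex _ Mn pM].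
  by exists [::]; rewrite big_nil K0_class_zero.
have [_ hg _ sg _] := ex; have [pQ [q eq]] := cQ S; have [hq sq _] := eq.
have [h [hh qh]] := pM _ _ _ _ hq sq hg.
have sh : surjmx h by apply: (essential_surj eq) => //; rewrite qh.
have [N' [f' ex']] := short_exact_ker hh sh.
have sp := projective_split_exact pQ ex'.
have [hf' _ _ _ _] := ex'.
have [s [hs hsE]] := projective_section pQ hh sh.
have [r [rf _ /(_ hs) hr]] := short_exact_retraction ex' hsE.
have dQ : mdim (Q S) != 0.
  have [S0 _] := asboolW (smodP S); apply: contraNneq S0 => Q0.
  have [w wE] := surjmx_section sq; rewrite -leqn0 -[X in (_ <= X)%N]Q0.
  by rewrite -[X in (X <= _)%N](mxrank1 k) -wE mulmx_max_rank.
have := dim_functorial_split (@functorial_full k L) sp; rewrite !dim_cV => dM.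
have [||ss' e] := IHn N'; last first.
- by exists (S :: ss'); rewrite (K0_class_split sp) e big_cons addrC.
- exact: projective_retract hf' hr rf pM.
by apply: leq_trans Mn; rewrite dM -addn1 leq_add2l lt0n.
Qed.

End ClassFormulas.

(** * The projective class ring *)

Section ProjectiveClassRing.
Context {k : fieldType} {L : hopfAlgType k}.
Variables (Lb : is_basic L) (Ls : is_split L).
Local Notation G := (structure_group Lb Ls).
Local Notation ZS := (monoid_ring G).
Implicit Types S T : simple_module L.

Lemma simple_mdim S : mdim S = 1.
Proof. exact: (simple_dim Ls Lb (asboolW (smodP S))). Qed.

Definition simple_class_K0 (g : G) : K0 L := K0_class (repr g).

Lemma simple_class_K0E S : simple_class_K0 (sclass S) = K0_class S.
Proof. exact/K0_class_iso/repr_sclass. Qed.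

Lemma simple_class_K01 : simple_class_K0 1%g = 1.
Proof. exact: simple_class_K0E. Qed.

Lemma simple_class_K0M (g h : G) :
  simple_class_K0 (g * h)%g = simple_class_K0 g * simple_class_K0 h.
Proof. by rewrite [(g * h)%g]/(sg_mul g h) simple_class_K0E K0_class_tens. Qed.

Definition semisimple_class : ZS -> K0 L := zext simple_class_K0.

HB.instance Definition _ := GRing.Additive.on semisimple_class.
HB.instance Definition _ := GRing.isMonoidMorphism.Build ZS (K0 L)
  semisimple_class (conj (zext1 simple_class_K01) (zextM simple_class_K0M)).

Definition semisimple_class_hom : {rmorphism ZS -> K0 L} := semisimple_class.

Lemma semisimple_classU S :
  semisimple_class_hom << (sclass S : G) >> = K0_class S.
Proof. by rewrite /= /semisimple_class zextU simple_class_K0E. Qed.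

Lemma semisimple_class_sum (ss : seq (simple_module L)) :
  semisimple_class_hom (\sum_(S <- ss) << (sclass S : G) >>) =
  \sum_(S <- ss) K0_class S.
Proof.
by rewrite (raddf_sum semisimple_class_hom); apply: eq_bigr => S _;
  apply: semisimple_classU.
Qed.

Variables (P1 : module L) (P1_cover : projective_cover P1 trivm).
Local Notation pi1 := (K0_class P1).
Local Notation sigma := semisimple_class_hom.

Lemma cover_simple S : projective_cover (tensm S P1) S.
Proof. exact: cover_tens1 (simple_mdim S) P1_cover. Qed.

Lemma K0_cover_central s : pi1 * sigma s = sigma s * pi1.
Proof.
apply: zext_comm => g; rewrite -!K0_class_tens; apply/K0_class_iso/iso_sym.
exact: tens1C_cover (simple_mdim _) P1_cover.
Qed.

(** The filtration of P1 (x) P1 induced by a composition series of the first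
    factor. *)
Lemma K0_cover_sqr : pi1 * pi1 = sigma (bar P1) * pi1.
Proof.
rewrite semisimple_class_sum mulr_suml; apply: K0_class_filtration => [S|].
  exact: (proj1 (cover_simple S)).
exact: svalP (cid (comp_series_exists P1)).
Qed.

Lemma adjoin_in_K0p x : projective P1 -> adjoin sigma pi1 x \in @K0p_pred k L.
Proof.
move=> pP; have gen M : projective M \/ semisimple M ->
    K0_class M \in @K0p_pred k L by move=> hM; apply/asboolP => A; apply.
have sg s : sigma s \in @K0p_pred k L.
  rewrite /= /semisimple_class /zext rpred_sum // => g _; rewrite rpredMz //.
  by apply: gen; right; apply: (simple_semisimple (asboolW (smodP _))).
by rewrite rpredD ?rpredM //; apply: gen; left.
Qed.

Lemma adjoin_onto_K0p y : y \in @K0p_pred k L ->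
  exists x, adjoin sigma pi1 x = y.
Proof.
pose A : pred (K0 L) := fun y => `[< exists x, adjoin sigma pi1 x = y >].
have rA : subring_closed A.
  split; first by apply/asboolP; exists (1, 0); rewrite adjoin1.
    move=> _ _ /asboolP [x <-] /asboolP [x' <-]; apply/asboolP.
    by exists (x - x'); apply: adjoinB.
  move=> _ _ /asboolP [[s1 t1] <-] /asboolP [[s2 t2] <-]; apply/asboolP.
  exists (s1 * s2, s1 * t2 + t1 * s2 + t1 * bar P1 * t2); symmetry.
  exact: (adjoinM K0_cover_central K0_cover_sqr).
pose mA := GRing.isSubringClosed.Build _ A rA.
pose A' : subringClosed (K0 L) := HB.pack A mA.
move=> /asboolP hy; apply/asboolP; apply: (hy A') => M [pM|sM]; apply/asboolP.
  have [ss ->] := K0_class_projective cover_simple pM.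
  exists (0, \sum_(S <- ss) << sclass S >>).
  rewrite /adjoin rmorph0 add0r semisimple_class_sum mulr_suml.
  by apply: eq_bigr => S _; rewrite K0_class_tens.
have [ss c] := comp_series_exists M; rewrite (K0_class_semisimple sM c).
exists (\sum_(S <- ss) << sclass S >>, 0).
by rewrite /adjoin rmorph0 mul0r addr0 semisimple_class_sum.
Qed.

(** In this case the trivial module is projective, hence so are its twists,
    which are all the simple modules, hence so are all modules. *)
Lemma cover_dim1_semisimple : mdim P1 = 1 -> semisimple_alg L.
Proof.
move=> d1; have [pP [p [hp sp _]]] := P1_cover.
have i : iso P1 trivm.
  case: (schur (simple_dim1 d1) (@simple_dim1 k L trivm erefl) hp) => // p0.
  by have [v] := surj_dim1_neq0 erefl sp; rewrite p0 mul0mx eqxx.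
have c : projective_cover (@trivm k L) trivm.
  exact: iso_cover i (iso_refl _) P1_cover.
apply: all_projective_semisimple; apply: simples_projective => S sS.
apply: iso_projective (iso_sym (iso_tensm1 S)) _.
exact: (proj1 (cover_tens1 (simple_dim Ls Lb sS) c)).
Qed.

(** A linear form that separates S from the other simple modules reads off the
    coefficient of S. *)
Lemma coef_detect (f : {additive K0 L -> int}) S y :
  (forall T, f (K0_class T * y) = (iso_rel S T)%:R) ->
  forall s, f (sigma s * y) = mcoeff (sclass S : G) s.
Proof.
move=> fE s; rewrite [LHS](additive_zext simple_class_K0) -zext_delta.
congr (zext _ s); apply/funext => g; rewrite [LHS]fE; congr (nat_of_bool _)%:R.
by rewrite -{2}[g]reprK eq_sym; apply/asboolP/sclassP.
Qed.

Lemma coef_vanish (f : {additive K0 L -> int}) y :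
  (forall T, f (K0_class T * y) = 0) -> forall s, f (sigma s * y) = 0.
Proof.
move=> fE s; rewrite [LHS](additive_zext simple_class_K0) /zext big1 // => g _.
by rewrite [X in X *~ _]fE mul0rz.
Qed.

Hypothesis L_nonsemisimple : ~ semisimple_alg L.

(** On s + t [P1] the form A of [exists_top_mult] has value s_S + t_S, and the
    form B of [exists_summand_mult] has value s_S, since the covers of the
    simple modules have dimension mdim P1 > 1. *)
Lemma adjoin_inj : injective (adjoin sigma pi1).
Proof.
suff ker x : adjoin sigma pi1 x = 0 -> x = 0.
  move=> x y e; apply/eqP; rewrite -subr_eq0; apply/eqP/ker.
  by rewrite adjoinB e subrr.
case: x => s t; rewrite /adjoin /= => e.
have P1d : mdim P1 != 1 by apply/eqP => /cover_dim1_semisimple.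
suff H S : mcoeff (sclass S : G) s = 0 /\ mcoeff (sclass S : G) t = 0.
  by congr pair; apply/malgP => g; rewrite mcoeff0;
    elim/(@sg_ind k L Lb Ls): g => S; case: (H S).
have [A AE] := exists_top_mult (simple_mdim S).
have [B [BS B0]] := exists_summand_mult (simple_mdim S).
have As : A (sigma s * 1) = mcoeff (sclass S : G) s.
  apply: coef_detect => T; rewrite mulr1.
  by apply: AE (@essential_id _ _ T); apply: simple_mdim.
have At : A (sigma t * pi1) = mcoeff (sclass S : G) t.
  apply: coef_detect => T; rewrite -K0_class_tens.
  have [_ [p ep]] := cover_simple T.
  by apply: AE ep; apply: simple_mdim.
have Bs : B (sigma s * 1) = mcoeff (sclass S : G) s.
  by apply: coef_detect => T; rewrite mulr1; apply/BS/simple_mdim.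
have Bt : B (sigma t * pi1) = 0.
  apply: coef_vanish => T; rewrite -K0_class_tens.
  have [_ [p ep]] := cover_simple T.
  by apply: B0 ep _; rewrite ?simple_mdim //= simple_mdim mul1n.
have ef (f : {additive K0 L -> int}) : f (sigma s * 1) + f (sigma t * pi1) = 0.
  by rewrite mulr1 -raddfD e raddf0.
have s0 : mcoeff (sclass S : G) s = 0 by have := ef B; rewrite Bs Bt addr0.
by split=> //; have := ef A; rewrite As At s0 add0r.
Qed.

End ProjectiveClassRing.

Theorem proposition3p9 (k : fieldType) (L : hopfAlgType k)
    (L_basic : is_basic L) (L_split : is_split L)
    (L_nonsemisimple : ~ semisimple_alg L)
    (P1 : module L) (P1_cover : projective_cover P1 trivm) :
  let ZS := monoid_ring (structure_group L_basic L_split) in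
  let c : ZS := bar P1 in
  exists phi : ZS * ZS -> K0p L,
    [/\ bijective phi,
        forall x y : ZS * ZS, phi (x + y) = phi x + phi y,
        phi (1, 0) = 1
      & forall s1 t1 s2 t2 : ZS,
          phi (s1, t1) * phi (s2, t2)
          = phi (s1 * s2, s1 * t2 + t1 * s2 + t1 * c * t2)].
Proof.
move=> ZS c; have [pP _] := P1_cover.
pose sigma := semisimple_class_hom L_basic L_split.
pose f := adjoin sigma (K0_class P1).
have pC := @K0_cover_central k L L_basic L_split P1 P1_cover.
have pp := @K0_cover_sqr k L L_basic L_split P1 P1_cover.
have fin x : f x \in @K0p_pred k L by apply: adjoin_in_K0p.
exists (fun x => K0pElt (fin x)); split.
- have sf y : exists x, K0pElt (fin x) = y.
    have [x e] := adjoin_onto_K0p L_basic L_split P1_cover (K0p_valP y).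
    by exists x; apply: val_inj.
  have [g gK] := boolp.choice sf; exists g => // x.
  apply: (adjoin_inj P1_cover L_nonsemisimple).
  exact (congr1 (@K0p_val k L) (gK (K0pElt (fin x)))).
- by move=> x y; apply: val_inj; apply: adjoinD.
- by apply: val_inj; apply: adjoin1.
by move=> s1 t1 s2 t2; apply: val_inj; apply: (adjoinM pC pp).
Qed.
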